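(* Suppose $A\subseteq M_n(K)$ is a Zariski-closed $F$-subalgebra with radical $J=\operatorname{Rad}(A)$, and $A/J=A_1\times\cdots\times A_k$ is a direct product of $k$ simple components. Then the matrix units of $M_n(K)$ can be chosen in such a way that $A$ has Wedderburn block form and all identifications among the diagonal blocks are Frobenius gluing; that is, for each $u$, any two glued diagonal blocks $A_u^{(\ell)}$ and $A_u^{(\ell')}$ have Frobenius gluing.
   Context: $F\subseteq K$ are fields, $F$ finite or infinite, $K$ algebraically closed; $q=|F|$ if $F$ is finite and $q=1$ if $F$ is infinite. $M_n(K)$ is identified with affine space $K^{n^2}$ with the Zariski topology; $A$ is Zariski-closed if it is a closed subset. $\operatorname{Rad}(A)$ is the largest nil (equivalently, nilpotent) ideal; $A/J$ is a finite direct product of matrix algebras $A_u\cong M_{n_u}(F_u)$ over fields $F_u$ (each isomorphic to a subfield of $K$). Wedderburn block form: $A$ is in Wedderburn block form (with respect to a set of matrix units of $M_n(K)$) if $n=\sum_{u=1}^k t(u)n_u$ and for each $u$ there are $t(u)$ distinct matrix blocks $A_u^{(1)},\dots,A_u^{(t(u))}$ of size $n_u\times n_u$ along the diagonal (the blocks for a given $u$ need not be consecutive), each isomorphic to $A_u$, such that the given representation $\varphi: A\to M_n(K)$ restricts (on the semisimple part of $A$, isomorphic to $A/J$) to embeddings $\varphi_u: A_u\to A_u^{(1)}\times\cdots\times A_u^{(t(u))}$ for which each projection $\varphi_u^{(\ell)}: A_u\to A_u^{(\ell)}$ is an isomorphism, and $J$ is embedded into the strictly upper triangular blocks (above the diagonal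 blocks). (If $A$ does not contain the identity matrix, an additional ''empty'' diagonal block, consisting only of $0$, is allowed.) For fixed $u$, the blocks $A_u^{(1)},\dots,A_u^{(t(u))}$ are said to be glued. For $\ell,\ell'\in\{1,\dots,t(u)\}$ let $\varphi_u^{\ell,\ell'}:A_u^{(\ell)}\to A_u^{(\ell')}$ be the isomorphism obtained by applying first $(\varphi_u^{(\ell)})^{-1}$ and then $\varphi_u^{(\ell')}$. Frobenius gluing: two glued diagonal blocks $A_u^{(\ell)}$, $A_u^{(\ell')}$ have Frobenius gluing of exponent $d\in\mathbb Z$ if, writing $e_{ij}^{(\ell)}$, $e_{ij}^{(\ell')}$ ($1\le i,j\le n_u$) for the corresponding $n_u\times n_u$ matrix units of $M_n(K)$ in these blocks, for all large enough $\kappa$ the isomorphism $\varphi_u^{\ell,\ell'}$ identifies $\sum\alpha_{ij}^{q^{d+\kappa}}e_{ij}^{(\ell)}$ in $A_u^{(\ell)}$ with $\sum\alpha_{ij}^{q^{\kappa}}e_{ij}^{(\ell')}$ in $A_u^{(\ell')}$.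
   Formalization: When A does not contain the identity matrix, several empty diagonal blocks (at any positions) are allowed instead of one; with a single empty block the claim fails, e.g. for the strictly upper triangular 2×2 matrices. *)

(* Defs.v *)
From HB Require Import structures.
From mathcomp Require Import all_boot all_order all_algebra.
From mathcomp Require Import mpoly.

Set Implicit Arguments.
Unset Strict Implicit.
Unset Printing Implicit Defensive.

Import GRing.Theory.
Local Open Scope ring_scope.

(* q = |F| if F is finite, and q = 1 if F is infinite. *)
Definition frobenius_base (F : fieldType) (q : nat) : Prop :=
  (exists s : seq F, [/\ uniq s, forall x, x \in s & q = size s]) \/
  ((~ exists s : seq F, forall x, x \in s) /\ q = 1%N).

Definition zariski_closed (K : fieldType) (n : nat)
    (A : 'M[K]_n -> Prop) : Prop :=
  exists P : {mpoly K[n * n]} -> Prop,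
    forall x, A x <-> forall p, P p -> p.@[fun i => mxvec x 0 i] = 0.

Section Algebras.

(* The inclusion of the base field F in K is given as a field morphism. *)
Variables (F K : fieldType) (iota : {rmorphism F -> K}) (n : nat).

(* A need not contain the identity matrix. *)
Definition subalgebra (A : 'M[K]_n -> Prop) : Prop :=
  [/\ A 0,
      forall x y, A x -> A y -> A (x + y),
      forall x y, A x -> A y -> A (x *m y)
    & forall c x, A x -> A (iota c *: x)].

Definition ideal_of (A I : 'M[K]_n -> Prop) : Prop :=
  [/\ forall x, I x -> A x,
      I 0,
      forall x y, I x -> I y -> I (x + y),
      forall c x, I x -> I (iota c *: x)
    & forall a x, A a -> I x -> I (a *m x) /\ I (x *m a)].

Definition nil_ideal (A I : 'M[K]_n -> Prop) : Prop :=
  ideal_of A I /\ forall x, I x -> exists m : nat, x ^+ m = 0.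

Definition is_radical (A J : 'M[K]_n -> Prop) : Prop :=
  nil_ideal A J /\ forall I, nil_ideal A I -> forall x, I x -> J x.

(* The maps pi u, restricted to A, induce an isomorphism of F-algebras from
   A / J onto the product over u of the matrix algebras M_(nu u)(L u), where
   L u is an F-algebra through alpha u.  The values of pi u outside A are
   irrelevant. *)
Definition quotient_isomorphism (A J : 'M[K]_n -> Prop) (k : nat)
    (nu : 'I_k -> nat) (L : 'I_k -> fieldType)
    (alpha : forall u, {rmorphism F -> L u})
    (pi : forall u, 'M[K]_n -> 'M[L u]_(nu u)) : Prop :=
  [/\ forall u x y, A x -> A y -> pi u (x + y) = pi u x + pi u y,
      forall u x y, A x -> A y -> pi u (x *m y) = pi u x *m pi u y,
      forall u c x, A x -> pi u (iota c *: x) = alpha u c *: pi u x,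
      forall x, A x -> (J x <-> forall u, pi u x = 0)
    & forall y : (forall u, 'M[L u]_(nu u)),
        exists2 x, A x & forall u, pi u x = y u].

End Algebras.

Section MatrixUnits.

Variables (K : fieldType) (n : nat).

Definition matrix_units (e : 'I_n -> 'I_n -> 'M[K]_n) : Prop :=
  (forall i j k l, e i j *m e k l = (j == k)%:R *: e i l) /\
  \sum_i e i i = 1%:M.

(* The element of M_n(K) whose matrix of coordinates with respect to the
   matrix units e is c. *)
Definition of_coords (e : 'I_n -> 'I_n -> 'M[K]_n) (c : 'M[K]_n) : 'M[K]_n :=
  \sum_i \sum_j c i j *: e i j.

End MatrixUnits.

(* A division of n into consecutive blocks.  A block with btype l = Some u is
   one of the t(u) blocks A_u^(1), ..., A_u^(t(u)), two such blocks with the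
   same u being glued; a block with btype l = None is an "empty" block. *)
Record layout (n k : nat) (nu : 'I_k -> nat) := Layout {
  nblocks : nat;
  bsize : 'I_nblocks -> nat;
  btype : 'I_nblocks -> option 'I_k;
  bsizeE : forall l u, btype l = Some u -> bsize l = nu u;
  bsize_sum : (\sum_l bsize l)%N = n
}.

Section Blocks.

Variables (K : fieldType) (n k : nat) (nu : 'I_k -> nat) (D : layout n nu).

Definition block (c : 'M[K]_n) (l l' : 'I_(nblocks D)) :
    'M[K]_(bsize l, bsize l') :=
  submxblock (castmx (esym (bsize_sum D), esym (bsize_sum D)) c) l l'.

Definition diag_block (c : 'M[K]_n) (u : 'I_k) (l : 'I_(nblocks D))
    (hl : btype l = Some u) : 'M[K]_(nu u) :=
  castmx (bsizeE hl, bsizeE hl) (block c l l).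

End Blocks.

Section BlockForm.

Variables (F K : fieldType) (iota : {rmorphism F -> K}) (n : nat).
Variables (A J : 'M[K]_n -> Prop).
Variables (k : nat) (nu : 'I_k -> nat) (L : 'I_k -> fieldType).
Variable alpha : forall u, {rmorphism F -> L u}.
Variable pi : forall u, 'M[K]_n -> 'M[L u]_(nu u).

(* The maps psi u identify the components A_u = M_(nu u)(L u) of A / J with
   subalgebras of A, by a section of the projection of A onto A / J; the sum
   of their images is the semisimple part of A. *)
Definition semisimple_part (psi : forall u, 'M[L u]_(nu u) -> 'M[K]_n) : Prop :=
  [/\ forall u y, A (psi u y),
      forall u y z, psi u (y + z) = psi u y + psi u z,
      forall u y z, psi u (y *m z) = psi u y *m psi u z,
      forall u c y, psi u (alpha u c *: y) = iota c *: psi u y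
    & (forall u y, pi u (psi u y) = y) /\
      (forall u v y z, u != v ->
         psi u y *m psi v z = 0 /\ pi v (psi u y) = 0)].

Variable e : 'I_n -> 'I_n -> 'M[K]_n.
Variable D : layout n nu.

(* phi u y is the matrix of coordinates, with respect to e, of the element of
   the semisimple part that corresponds to y in A_u.  Since phi u y is block
   diagonal, each map y |-> diag_block (phi u y) hl is multiplicative, so that
   its injectivity makes it an isomorphism onto its image A_u^(l). *)
Definition wedderburn_block_form
    (phi : forall u, 'M[L u]_(nu u) -> 'M[K]_n) : Prop :=
  [/\ semisimple_part (fun u y => of_coords e (phi u y)),
      forall u y (l l' : 'I_(nblocks D)),
        (l != l') || (btype l != Some u) -> block (phi u y) l l' = 0,
      forall u (l : 'I_(nblocks D)) (hl : btype l = Some u),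
        injective (fun y => diag_block (phi u y) hl),
      forall c, J (of_coords e c) ->
        forall l l' : 'I_(nblocks D), (l' <= l)%N -> block c l l' = 0
    & (exists l : 'I_(nblocks D), btype l = None) -> ~ A 1%:M].

End BlockForm.

Section Gluing.

Variables (K L : fieldType) (n k : nat) (nu : 'I_k -> nat) (D : layout n nu).
Variables (u : 'I_k) (phi : 'M[L]_(nu u) -> 'M[K]_n).
Variables (l l' : 'I_(nblocks D)).
Variables (hl : btype l = Some u) (hl' : btype l' = Some u).

Definition in_block (X : 'M[K]_(nu u)) : Prop :=
  exists y, diag_block (phi y) hl = X.

(* The graph of the isomorphism from A_u^(l) to A_u^(l') obtained by composing
   the inverse of the projection on block l with the projection on block l'. *)
Definition glued_to (X X' : 'M[K]_(nu u)) : Prop :=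
  exists y, diag_block (phi y) hl = X /\ diag_block (phi y) hl' = X'.

(* The exponent m = d + kappa is a natural number for all large kappa. *)
Definition frobenius_gluing (q : nat) (d : int) : Prop :=
  exists N : nat, forall kappa m : nat,
    (N <= kappa)%N -> m%:Z = d + kappa%:Z ->
    forall a : 'M[K]_(nu u),
      in_block (map_mx (fun x => x ^+ (q ^ m)) a) ->
      glued_to (map_mx (fun x => x ^+ (q ^ m)) a)
               (map_mx (fun x => x ^+ (q ^ kappa)) a).

End Gluing.

(* Main.v *)
Require Import Defs.
From HB Require Import structures.
From mathcomp Require Import all_boot all_order all_algebra all_solvable all_field.
From mathcomp Require Import mpoly.
From Stdlib Require Import Classical ClassicalEpsilon.

Set Implicit Arguments.
Unset Strict Implicit.
Unset Printing Implicit Defensive.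

Import GRing.Theory.
Local Open Scope ring_scope.

(** Let [e] be a primitive idempotent of [A] that lifts a diagonal unit of the
    component [M_(nu u)(L u)]; the corner [e A e] maps onto the field [L u] with
    nil kernel.  The whole theorem rests on one statement about such a corner
    ([corner_section]): in some basis of [K^n], every element of [L u] lifts to
    an element of the corner that is diagonal, and any two nonzero diagonal
    entries of these lifts, as functions on [L u], are powers of each other with
    exponent a power of [q].  Since a diagonal element of the corner is nilpotent
    only if it is zero, the lifts are unique in the given basis, so they form a
    homomorphism of [F]-algebras and their entries are embeddings of [L u]
    in [K].

    In that basis let [T] be the set of the diagonals of all diagonal elements of
    the corner.  It is a closed ring, and a nonzero member of [T] vanishes
    nowhere on the support of [e].  If [F] is infinite, then [T] contains the
    closure [K e] of [F e].  If [F] is finite, of characteristic [p], suppose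
    that [T] is infinite.  By the independence of characters, [T] is cut out by
    differences of monomials.  If two coordinates were not related by powers
    of [p], then, the multiplicative group of [K] being divisible, some point
    satisfying all these binomial equations would have coordinates [1] and
    [zeta <> 1] there; subtracting the unit of [T] would give a nonzero member
    that vanishes somewhere on the support ([domain_coords_related]).  So all
    coordinates are Frobenius twists of one of them, and [T] contains a curve
    [b |-> (b ^ (p ^ w i))_i] parametrized by the whole field [K]
    ([domain_frobenius_curve]).  In both cases [T] contains a copy of the
    algebraically closed field [K], and the Cayley-Hamilton argument of
    [curve_surjective] shows that this copy already maps onto [L u].

    For finite [F] a basis with infinite [T] comes from a single element: the
    [p^n]-th power of any matrix of size [n] is diagonalizable, so a lift of an
    element of infinite multiplicative order can be used.  When all nonzero
    elements of [L u] are roots of unity, one takes instead a largest commuting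
    family of diagonalizable elements of the corner; averaging over the powers
    of its members lifts every element of [L u] to one that commutes with the
    family ([torsion_frame]).  Then [T] maps onto [L u], and if [L u] is finite
    its embeddings are compared on a generator
    ([finite_embeddings_related]).

    Matrix units lift from [A / J] to [A], the radical being nil
    ([lift_matrix_units]), and combine with the sections of the corners into a
    section of the projection of [A] onto [A / J].  The basis of [K^n] is built
    block by block from the last block upwards.  If [U] is the span of the blocks
    found so far, then the Engel-Jacobson theorem ([nil_semigroup_action]) gives
    a vector outside [U] that [J] maps into [U]; one of its components is a
    common eigenvector of one of the corner sections outside [U], and the images
    of this eigenvector under the matrix units form a new block
    ([block_flag_extend]).  Each diagonal block is then the image of a component
    under an embedding of [L u] applied to the entries, which reduces the gluing
    to the relation between the embeddings. *)

(** * Choice and rank *)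

Lemma dependent_choice (I : Type) (T : I -> Type) (P : forall i, T i -> Prop) :
  (forall i, exists x, P i x) -> exists f : forall i, T i, forall i, P i (f i).
Proof.
move=> Pex; exists (fun i => proj1_sig (constructive_indefinite_description _ (Pex i))).
by move=> i; apply: proj2_sig (constructive_indefinite_description _ (Pex i)).
Qed.

Lemma least_nat (D : nat -> Prop) : (exists d, D d) ->
  exists2 d, D d & forall d', D d' -> (d <= d')%N.
Proof.
case=> d0; elim/ltn_ind: d0 => d0 IHd Dd0.
have [[d' [lt_d' Dd']]|no_d'] := classic (exists d', (d' < d0)%N /\ D d').
  exact: IHd lt_d' Dd'.
exists d0 => // d' Dd'; rewrite leqNgt; apply/negP => lt_d'.
by apply: no_d'; exists d'.
Qed.

Lemma rank_adds_genmx (K : fieldType) n (v : 'rV[K]_n) (U : 'M[K]_n) :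
  ~~ (v <= U)%MS -> (\rank U < \rank (<<v>> + U))%N.
Proof.
move=> vU; apply: rank_ltmx; rewrite /ltmx addsmxSr /=.
apply: contra vU => le_v; apply: submx_trans le_v.
by rewrite (submx_trans _ (addsmxSl _ _)) ?genmxE.
Qed.

(** * Spans of lists of matrices *)

Section Span.

Variables (K : fieldType) (n : nat).
Implicit Types (s : seq 'M[K]_n) (x y : 'M[K]_n).

Definition mspan s : 'M[K]_(n * n) := (\sum_(t <- s) <<mxvec t>>)%MS.

Lemma mspan_cons t s : mspan (t :: s) = (<<mxvec t>> + mspan s)%MS.
Proof. by rewrite /mspan big_cons. Qed.

Lemma mem_mspan t s : t \in s -> (mxvec t <= mspan s)%MS.
Proof.
elim: s => // a s IHs; rewrite inE mspan_cons => /orP[/eqP <-|/IHs ts].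
  by rewrite (submx_trans _ (addsmxSl _ _)) ?genmxE.
exact: submx_trans ts (addsmxSr _ _).
Qed.

Lemma mspan_ind (P : 'M[K]_n -> Prop) s :
  P 0 -> (forall x y, P x -> P y -> P (x + y)) ->
  (forall c x, P x -> P (c *: x)) -> (forall t, t \in s -> P t) ->
  forall x, (mxvec x <= mspan s)%MS -> P x.
Proof.
move=> P0 PD PZ; elim: s => [|a s IHs] Ps x.
  rewrite /mspan big_nil submx0 mxvec_eq0 => /eqP ->.
  exact: P0.
rewrite mspan_cons => /sub_addsmxP[[u1 u2] /= def_x].
have /submxP[c def_c] : (u1 *m <<mxvec a>> <= mxvec a)%MS.
  by rewrite (submx_trans (submxMl _ _)) ?genmxE.
rewrite -[x]mxvecK def_x linearD /=; apply: PD; last first.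
  apply: IHs => [t ts|]; first by apply: Ps; rewrite inE ts orbT.
  by rewrite vec_mxK submxMl.
rewrite def_c [c]mx11_scalar mul_scalar_mx linearZ /= mxvecK; apply: PZ.
by apply: Ps; rewrite mem_head.
Qed.

(** The rank of the span is bounded, so a list cannot be lengthened for ever by
    matrices that lie outside its span. *)
Lemma maximal_mspan (P : seq 'M[K]_n -> Prop) s : P s ->
  exists2 s', P s' &
    {subset s <= s'} /\ forall t, P (t :: s') -> (mxvec t <= mspan s')%MS.
Proof.
move: {2}(_ - _)%N (leqnn (n * n - \rank (mspan s))) => m.
elim: m s => [|m IHm] s lem Ps.
  exists s => //; split=> // t _; apply: submx_full.
  by rewrite /row_full eqn_leq rank_leq_row -subn_eq0 -leqn0.
case: (classic (forall t, P (t :: s) -> (mxvec t <= mspan s)%MS)).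
  by move=> max_s; exists s => //; split.
move=> /not_all_ex_not[t nPt].
have [Pts nts] := imply_to_and _ _ nPt.
have [|s' Ps' [sub_s' max_s']] := IHm _ _ Pts; last first.
  exists s' => //; split=> // x xs.
  by apply: sub_s'; rewrite inE xs orbT.
have lt_rank : (\rank (mspan s) < \rank (mspan (t :: s)))%N.
  by rewrite mspan_cons rank_adds_genmx //; apply/negP.
rewrite -ltnS; apply: leq_trans lem; apply: ltn_sub2l => //.
exact: leq_trans lt_rank (rank_leq_row _).
Qed.

End Span.

(** * Multiplicative sets of nilpotent matrices *)

Section Engel.

Variables (K : fieldType) (n : nat).

(** A form of simultaneous strict triangularity that passes to the linear span
    of [T] and, unlike nilpotency of products, is easily extended to one more
    matrix. *)
Definition nil_action (T : 'M[K]_n -> Prop) : Prop :=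
  forall U : 'M[K]_n, ~~ row_full U ->
  exists2 v : 'rV_n, ~~ (v <= U)%MS & forall t, T t -> (v *m t <= U)%MS.

(** Starting from [0], the vectors given by [nil_action] can be added one after
    the other to a subspace stable under [T], which stays stable; this builds a
    flag that every factor of the product descends. *)
Lemma nil_action_prod (T : 'M[K]_n -> Prop) : nil_action T ->
  exists k, forall f : nat -> 'M[K]_n, (forall i, T (f i)) ->
  \prod_(i < k) f i = 0.
Proof.
move=> nilT.
suff main m (U : 'M[K]_n) : (n - \rank U <= m)%N ->
    (forall t, T t -> (U *m t <= U)%MS) ->
    exists k, forall f : nat -> 'M[K]_n, (forall i, T (f i)) ->
    (\prod_(i < k) f i <= U)%MS.
  have [|t _|k Hk] := main n 0; first by rewrite mxrank0 subn0.
    by rewrite mul0mx sub0mx.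
  by exists k => f /Hk; rewrite submx0 => /eqP.
elim: m U => [|m IHm] U lem stabU.
  exists 0%N => f _; apply: submx_full.
  by rewrite /row_full eqn_leq rank_leq_row -subn_eq0 -leqn0.
have [fullU|/nilT[v vU vT]] := boolP (row_full U).
  by exists 0%N => f _; apply: submx_full.
have [||k Hk] := IHm (<<v>> + U)%MS.
- rewrite -ltnS; apply: leq_trans lem; apply: ltn_sub2l.
    exact: leq_trans (rank_adds_genmx vU) (rank_leq_row _).
  exact: rank_adds_genmx.
- move=> t Tt; rewrite addsmxMr addsmx_sub.
  rewrite (submx_trans (stabU _ Tt)) ?addsmxSr // andbT.
  by rewrite (submx_trans _ (addsmxSr _ _)) // (eqmxMr _ (genmxE v)) vT.
exists k.+1 => f Tf; rewrite big_ord_recr /= -mulmxE.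
have /sub_addsmxP[[u1 u2] /= ->] := Hk f Tf.
rewrite mulmxDl -!mulmxA addmx_sub // mulmx_sub //; last exact: stabU.
by rewrite (eqmxMr _ (genmxE v)) vT.
Qed.

(** Jacobson's form of Engel's theorem.  Among the lists of members of [R] that
    act nilpotently, take one whose span is as large as possible.  If [R] is
    not contained in this span, then some [r] of [R] outside it is multiplied
    into it by the list, since products of many members of the list vanish.
    The space [{v | v T <= U}] is then stable under [r], so that the last
    nonzero power of [r] on it shows that [r] can be added to the list. *)
Theorem nil_semigroup_action (R : 'M[K]_n -> Prop) :
  (forall x y, R x -> R y -> R (x *m y)) ->
  (forall x, R x -> exists m : nat, x ^+ m = 0) -> nil_action R.
Proof.
move=> RM Rnil.
pose P (s : seq 'M[K]_n) := (forall t, t \in s -> R t) /\ nil_action (fun t => t \in s).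
have P0 : P [::].
  split=> // U; rewrite -sub1mx => /row_subPn[i ?].
  by exists (row i 1%:M).
have [s [Rs nil_s] [_ max_s]] := maximal_mspan P0.
have nil_span : nil_action (fun x => (mxvec x <= mspan s)%MS).
  move=> U /nil_s[v vU vs]; exists v => // t.
  apply: (mspan_ind (P := fun t => (v *m t <= U)%MS)) => //.
  - by rewrite mulmx0 sub0mx.
  - by move=> x y vx vy; rewrite mulmxDr addmx_sub.
  - by move=> c x vx; rewrite -scalemxAr scalemx_sub.
suff R_span x : R x -> (mxvec x <= mspan s)%MS.
  by move=> U /nil_span[v vU vs]; exists v => // t /R_span/vs.
move=> Rx; apply: NNPP => x_span.
have [r [Rr r_span rs]] : exists r, [/\ R r, ~ (mxvec r <= mspan s)%MS &
    forall t, t \in s -> (mxvec (r *m t) <= mspan s)%MS].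
  apply: NNPP => no_r.
  have step y : R y /\ ~ (mxvec y <= mspan s)%MS ->
      exists t, t \in s /\ ~ (mxvec (y *m t) <= mspan s)%MS.
    move=> [Ry y_span]; apply: NNPP => no_t; apply: no_r; exists y.
    by split=> // t ts; apply: NNPP => yt; apply: no_t; exists t.
  have choice y : exists t, R y /\ ~ (mxvec y <= mspan s)%MS ->
      t \in s /\ ~ (mxvec (y *m t) <= mspan s)%MS.
    have [/step[t ?]|] := classic (R y /\ ~ (mxvec y <= mspan s)%MS).
      by exists t.
    by exists 0.
  have [nxt nxtP] := dependent_choice choice.
  pose z i := iter i (fun y => y *m nxt y) x.
  have zP i : R (z i) /\ ~ (mxvec (z i) <= mspan s)%MS.
    elim: i => [|i IHi]; first by [].
    have [ts zt] := nxtP _ IHi; split=> //.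
    by apply: RM; [case: IHi | apply: Rs].
  have [k Hk] := nil_action_prod nil_s.
  have def_z i : z i = x *m \prod_(j < i) nxt (z j).
    elim: i => [|i IHi]; first by rewrite big_ord0 mulmx1.
    by rewrite big_ord_recr /= -mulmxE mulmxA -IHi.
  have [_ []] := zP k; rewrite def_z (Hk (fun j => nxt (z j))) ?mulmx0 ?linear0 ?sub0mx // => i.
  by have [] := nxtP _ (zP i).
apply: r_span; apply: max_s; split=> [t|U /nil_span[v vU vs]].
  by rewrite inE => /orP[/eqP ->|/Rs].
have [m rm] := Rnil r Rr.
have stab j t : (mxvec t <= mspan s)%MS -> (v *m r ^+ j *m t <= U)%MS.
  elim: j t => [|j IHj] t ts; first by rewrite expr0 mulmx1 vs.
  apply: (mspan_ind (P := fun t => (v *m r ^+ j.+1 *m t <= U)%MS) _ _ _ _ ts).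
  - by rewrite mulmx0 sub0mx.
  - by move=> x1 y vx vy; rewrite mulmxDr addmx_sub.
  - by move=> c y vx; rewrite -scalemxAr scalemx_sub.
  - by move=> y /rs/IHj; rewrite exprSr -mulmxE !mulmxA.
have exj : exists j, (v *m r ^+ j <= U)%MS.
  by exists m; rewrite rm mulmx0 sub0mx.
case: (ex_minnP exj) => [[|j] vj minj].
  by rewrite expr0 mulmx1 (negPf vU) in vj.
exists (v *m r ^+ j).
  by apply/negP => /minj; rewrite ltnn.
move=> t; rewrite inE => /orP[/eqP ->|ts]; last by apply: stab; apply: mem_mspan.
by rewrite -mulmxA mulmxE -exprSr.
Qed.

End Engel.

(** * Roots and powers in an algebraically closed field *)

Section PcharPowers.

Variables (K : fieldType) (p : nat) (pchK : p \in [pchar K]).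

Lemma exp_pchar_inj e : injective (fun x : K => x ^+ (p ^ e)).
Proof.
move=> x y /= /eqP; have p_pr := pcharf_prime pchK.
rewrite -subr_eq0 -exprNn_pchar ?pnatX ?pnatE ?pchK // => /eqP xy.
have : (x - y) ^+ (p ^ e) == 0.
  by rewrite exprDn_pchar ?pnatX ?pnatE ?pchK // xy.
by rewrite expf_eq0 subr_eq0 => /andP[_ /eqP].
Qed.

Lemma exp_pcharD e (x y : K) :
  (x + y) ^+ (p ^ e) = x ^+ (p ^ e) + y ^+ (p ^ e).
Proof. by rewrite exprDn_pchar // pnatX pnatE ?pchK // (pcharf_prime pchK). Qed.

End PcharPowers.

Section Powers.

Variable K : closedFieldType.

Lemma closed_root_exists (a : K) d : (0 < d)%N -> exists z, z ^+ d = a.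
Proof.
move=> d_gt0; have [|z] := closed_rootP ('X^d - a%:P) _.
  by rewrite size_XnsubC // eqSS -lt0n.
by rewrite rootE !hornerE subr_eq0 => /eqP ?; exists z.
Qed.

Lemma poly0_of_roots (P : {poly K}) :
  (forall s : seq K, exists2 x, x \notin s & root P x) -> P = 0.
Proof.
move=> rootsP; apply/eqP/negP => /negP P0.
have [r def_P] := closed_field_poly_normal P; have [x xr] := rootsP r.
by rewrite def_P rootZ ?lead_coef_eq0 // root_prod_XsubC (negPf xr).
Qed.

Lemma closed_field_infinite (s : seq K) : exists x, x \notin s.
Proof.
apply: NNPP => all_s; pose P : {poly K} := \prod_(z <- s) ('X - z%:P).
have /closed_nonrootP[x] : P != 0.
  by rewrite -lead_coef_eq0 (monicP _) ?oner_eq0 // monic_prod_XsubC.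
by rewrite root_prod_XsubC => xs; apply: all_s; exists x.
Qed.

Variables (p : nat) (pchK : p \in [pchar K]).

(** Writing [c = p^e c'] with [c'] prime to [p], the hypothesis gives
    [(X + 1)^c' = X^c' + 1], whose derivative at [0] is [c' = 0] unless
    [c' = 1]. *)
Lemma additive_exp_pow (c : nat) : (0 < c)%N ->
  (forall x : K, (x + 1) ^+ c = x ^+ c + 1) -> exists e, c = (p ^ e)%N.
Proof.
move=> c_gt0 addc; have p_pr := pcharf_prime pchK.
have [c' pc' def_c] := pfactor_coprime p_pr c_gt0.
exists (logn p c); suff c'1 : c' = 1%N by rewrite {1}def_c c'1 mul1n.
have addc' (y : K) : (y + 1) ^+ c' = y ^+ c' + 1.
  have pe_gt0 : (0 < p ^ logn p c)%N by rewrite expn_gt0 prime_gt0.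
  have [x <-] := closed_root_exists y pe_gt0.
  by have := addc x; rewrite {1 2}def_c mulnC !exprM (exp_pcharD pchK) expr1n.
pose P : {poly K} := ('X + 1%:P) ^+ c' - 'X ^+ c' - 1%:P.
have P0 : P = 0.
  apply: poly0_of_roots => r; have [x xr] := closed_field_infinite r.
  by exists x; rewrite // rootE !hornerE addc' addrAC addrK subrr.
have /eqP := congr1 (fun Q : {poly K} => Q^`().[0]) P0.
rewrite /P !derivE deriv_exp !derivE !(hornerE, hornerMn) /= expr1n.
rewrite expr0n subr0.
case: c' pc' {def_c addc' P P0} => [|[|c']] //= pc'.
  by rewrite /coprime gcdn0 in pc'; rewrite (eqP pc') in p_pr.
rewrite mul0rn subr0 -(dvdn_pcharf pchK) => pc.
by have := coprime_dvdr pc pc'; rewrite /coprime gcdnn => /eqP p1; rewrite p1 in p_pr.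
Qed.

Lemma additive_expz (c : int) :
  (forall s : seq K, exists x,
     [/\ x \notin s, x != 0, x + 1 != 0 & (x + 1) ^ c = x ^ c + 1]) ->
  exists e, c = (p ^ e)%N.
Proof.
have inf (P : {poly K}) (Q : K -> Prop) : (forall x, Q x -> root P x) ->
  (forall s : seq K, exists x, x \notin s /\ Q x) -> P = 0.
  move=> QP Qinf; apply: poly0_of_roots => s; have [x [xs /QP]] := Qinf s.
  by exists x.
case: c => [[|c]|c] addc.
- have [x [_ _ _]] := addc [::]; rewrite !expr0z => /eqP.
  by rewrite -subr_eq0 opprD addrA subrr add0r oppr_eq0 oner_eq0.
- have [x|e ->] := @additive_exp_pow c.+1 isT; last by exists e.
  pose P : {poly K} := ('X + 1%:P) ^+ c.+1 - 'X ^+ c.+1 - 1%:P.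
  have P0 : P = 0.
    apply: (inf _ (fun x => (x + 1) ^+ c.+1 = x ^+ c.+1 + 1)) => [y add_y|s].
      by rewrite rootE !hornerE add_y addrAC addrK subrr.
    by have [y [ys _ _ add_y]] := addc s; exists y.
  have /eqP := congr1 (fun Q : {poly K} => Q.[x]) P0.
  by rewrite !hornerE -addrA -opprD subr_eq0 => /eqP.
(* A negative exponent gives, after multiplication by the denominators, a
   polynomial identity that fails at 0. *)
pose P : {poly K} := 'X ^+ c.+1 - ('X + 1%:P) ^+ c.+1 * (1%:P + 'X ^+ c.+1).
have P0 : P = 0.
  apply: (inf _ (fun x => [/\ x != 0, x + 1 != 0 &
                             (x + 1) ^ Negz c = x ^ Negz c + 1])).
    move=> x [x0 x1]; rewrite !NegzE -!exprnN => add_x.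
    rewrite rootE !hornerE subr_eq0; apply/eqP.
    have := congr1 (fun z => x ^+ c.+1 * (x + 1) ^+ c.+1 * z) add_x.
    rewrite mulfK ?expf_neq0 // => {1}->; rewrite mulrDr mulr1 mulrAC.
    by rewrite mulfV ?expf_neq0 // mul1r mulrDr mulr1 (mulrC (x ^+ _)).
  by move=> s; have [y [? ? ? ?]] := addc s; exists y.
have /eqP := congr1 (fun Q : {poly K} => Q.[0]) P0.
rewrite /P !hornerE expr0n /= expr1n addr0 mulr1 sub0r.
by rewrite oppr_eq0 oner_eq0.
Qed.

End Powers.

(** * Linear relations between multiplicative functions *)

(** Dedekind's independence of characters, for a list that may contain equal
    functions.  Let [E] be the sum to be shown zero.  Removing [i] from the
    relation by the usual elimination, the induction hypothesis says that
    [E * chi i] is the same function for all [i] in the list.  So either [E]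
    vanishes, or all the functions of the list are equal. *)
Lemma multiplicative_relation (K : fieldType) (I : eqType) (X : Type)
    (mulX : X -> X -> X) (oneX : X) (chi : I -> X -> K) (ev : I -> K) :
  (forall i x y, chi i (mulX x y) = chi i x * chi i y) ->
  (forall i, chi i oneX = 1 \/ ev i = 0) ->
  (forall i j, chi i =1 chi j -> ev i = ev j) ->
  forall (s : seq I) (c : I -> K),
  (forall x, \sum_(i <- s) c i * chi i x = 0) -> \sum_(i <- s) c i * ev i = 0.
Proof.
move=> chiM chi1 chi_ev s; have [m] := ubnP (size s).
elim: m s => // m IHm s lt_s c rel_s.
set E := \sum_(i <- s) c i * ev i.
have E_chi i b : i \in s -> E * chi i b = \sum_(j <- s) c j * ev j * chi j b.
  move=> si; have perm_s := perm_to_rem si.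
  have size_rem : (size (rem i s) < m)%N.
    by move: lt_s; rewrite (perm_size perm_s).
  have rel0 : \sum_(j <- rem i s) c j * (chi j b - chi i b) * ev j = 0.
    apply: (IHm _ size_rem) => x.
    have : \sum_(j <- s) c j * (chi j b - chi i b) * chi j x = 0.
      rewrite (eq_bigr (fun j => c j * chi j (mulX b x) - chi i b * (c j * chi j x))).
        by rewrite sumrB rel_s -mulr_sumr rel_s mulr0 subrr.
      by move=> j _; rewrite chiM mulrBr mulrBl !mulrA (mulrC (c j) (chi i b)).
    by rewrite (perm_big _ perm_s) big_cons /= subrr mulr0 mul0r add0r.
  apply/eqP; rewrite eq_sym -subr_eq0 mulr_suml -sumrB; apply/eqP.
  rewrite (perm_big _ perm_s) big_cons /= subrr add0r -[RHS]rel0.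
  by apply: eq_bigr => j _; rewrite -mulrBr mulrAC.
have [//|E0] := eqVneq E 0.
have chi_eq i j : i \in s -> j \in s -> chi i =1 chi j.
  by move=> si sj x; apply: (mulfI E0); rewrite !E_chi.
have [s0|[i0 si0]] : s = [::] \/ exists i0, i0 \in s.
  by case: (s) => [|i0 s']; [left | right; exists i0; rewrite mem_head].
  by rewrite /E s0 big_nil.
have ev_eq i : i \in s -> ev i = ev i0.
  by move=> si; apply: chi_ev; apply: chi_eq.
rewrite /E; have [chi1_i0|ev0] := chi1 i0.
  have := rel_s oneX; rewrite big_seq_cond => rel1.
  rewrite big_seq_cond (eq_bigr (fun i => c i * chi i oneX * ev i0)).
    by rewrite -mulr_suml rel1 mul0r.
  move=> i /andP[si _]; rewrite ev_eq //.
  by rewrite (chi_eq i i0 si si0) chi1_i0 mulr1.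
by rewrite big_seq_cond big1 // => i /andP[si _]; rewrite ev_eq // ev0 mulr0.
Qed.

(** * Points of tori *)

Section Torus.

Variables (K : closedFieldType) (n : nat).
Implicit Types (x : 'I_n -> K) (m : {ffun 'I_n -> int}).

Definition lmon x m : K := \prod_i x i ^ m i.

Lemma lmon0 x : lmon x 0 = 1.
Proof. by rewrite /lmon big1 // => i _; rewrite ffunE expr0z. Qed.

Lemma lmonD x m m' : (forall i, x i != 0) ->
  lmon x (m + m') = lmon x m * lmon x m'.
Proof.
move=> x0; rewrite /lmon -big_split; apply: eq_bigr => i _.
by rewrite ffunE expfzDr.
Qed.

Lemma lmonN x m : lmon x (- m) = (lmon x m)^-1.
Proof.
by rewrite /lmon -prodfV; apply: eq_bigr => i _; rewrite ffunE invr_expz.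
Qed.

Lemma lmonMz x m c : (forall i, x i != 0) -> lmon x (m *~ c) = lmon x m ^ c.
Proof.
move=> x0; have natE k : lmon x (m *+ k) = lmon x m ^+ k.
  by elim: k => [|k IHk]; rewrite ?lmon0 // mulrS lmonD // IHk exprS.
by case: c => k; [apply: natE | rewrite NegzE mulrNz lmonN natE exprnN].
Qed.

(** The multiplicative group of [K] is divisible, hence injective: a character
    of a subgroup of [Z^n] extends to [Z^n].  The character is given by its
    graph [R], and the coordinates of [x] are chosen one after the other. *)
Lemma extend_character (R : {ffun 'I_n -> int} -> K -> Prop) :
  R 0 1 -> (forall m y m' y', R m y -> R m' y' -> R (m - m') (y / y')) ->
  (forall m y, R m y -> y != 0) -> (forall y, R 0 y -> y = 1) ->
  exists2 x, (forall i, x i != 0) & forall m y, R m y -> lmon x m = y.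
Proof.
move=> R0 RB Rn0 R1.
have RN m y : R m y -> R (- m) y^-1.
  by move=> Rmy; rewrite -sub0r -div1r; apply: RB.
have RD m y m' y' : R m y -> R m' y' -> R (m + m') (y * y').
  by move=> Rmy /RN Rmy'; rewrite -[m']opprK -[y']invrK; apply: RB.
have RZ m y c : R m y -> R (m *~ c) (y ^ c).
  move=> Rmy; have natR k : R (m *+ k) (y ^+ k).
    by elim: k => [|k IHk] //; rewrite mulrS exprS; apply: RD.
  case: c => k; first exact: natR.
  by rewrite NegzE mulrNz -exprnN; apply: RN; apply: natR.
suff main k : (k <= n)%N -> exists2 x, (forall i, x i != 0) &
    forall m y, R m y -> (forall i : 'I_n, (k <= i)%N -> m i = 0) ->
    lmon x m = y.
  have [x x0 xR] := main n (leqnn n); exists x => // m y Rmy.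
  by apply: xR => // i; rewrite leqNgt ltn_ord.
elim: k => [_|k IHk lt_kn].
  exists (fun=> 1) => [i|m y Rmy m0]; first exact: oner_neq0.
  have def_m : m = 0 by apply/ffunP=> i; rewrite ffunE; apply: m0.
  by move: Rmy; rewrite def_m lmon0 => /R1.
have [x x0 xR] := IHk (ltnW lt_kn); pose i0 := Ordinal lt_kn.
pose supp_k m := forall i : 'I_n, (k < i)%N -> m i = 0.
have suppS m : supp_k m -> m i0 = 0 -> forall i : 'I_n, (k <= i)%N -> m i = 0.
  move=> mk m0 i; rewrite leq_eqVlt => /predU1P[ki|]; last exact: mk.
  by rewrite -[i](_ : i0 = i) //; apply: val_inj.
(* The values at i0 of the exponents under consideration form a subgroup of Z;
   its least positive member d determines the new coordinate up to d-th roots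
   of unity. *)
pose D d := (0 < d)%N /\ exists m y, [/\ R m y, supp_k m & m i0 = d].
have [[d0 Dd0]|noD] := classic (exists d, D d); last first.
  exists x => // m y Rmy mk; apply: xR => //; apply: suppS => //.
  have : ~ D `|m i0|%N.
    by move=> Dm; apply: noD; exists `|m i0|%N.
  case def_d: (m i0) => [[|d]|d] // [] /=; split=> //.
    by exists m, y.
  exists (- m), y^-1; split=> [|i ki|]; first exact: RN.
    by rewrite ffunE mk ?oppr0.
  by rewrite ffunE def_d NegzE opprK.
have [d [d_gt0 [ms [ys [Rs sk def_d]]]] min_d] := least_nat (ex_intro _ d0 Dd0).
have d_neq0 : d%:Z != 0 by case: (d) d_gt0.
pose a := ys / \prod_(i | i != i0) x i ^ ms i.
have [z zd] := closed_root_exists a d_gt0.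
pose x' i := if i == i0 then z else x i.
have prod_neq0 m : \prod_(i | i != i0) x i ^ m i != 0.
  by apply/prodf_neq0 => i _; apply: expfz_neq0.
have a0 : a != 0 by rewrite mulf_neq0 ?invr_eq0 // (Rn0 _ _ Rs).
have x'0 i : x' i != 0.
  rewrite /x'; case: ifP => // _; apply: contraNneq a0 => z0.
  by rewrite -zd z0 expr0n gtn_eqF.
have lmon_x' m : lmon x' m = z ^ m i0 * \prod_(i | i != i0) x i ^ m i.
  rewrite /lmon (bigD1 i0) //= {1}/x' eqxx; congr (_ * _).
  by apply: eq_bigr => i /negPf; rewrite /x' => ->.
exists x' => // m y Rmy mk.
have /esym def_m := divz_eq (m i0) d; set c := (m i0 %/ d)%Z in def_m.
pose m' := m - ms *~ c; pose y' := y / ys ^ c.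
have Rm' : R m' y' by apply: RB => //; apply: RZ.
have ms_c i : (ms *~ c) i = ms i * c.
  have natE k' : (ms *+ k') i = ms i * k'%:Z.
    elim: k' => [|k' IHk']; first by rewrite mulr0 ffunE.
    by rewrite mulrS ffunE IHk' intS mulrDr mulr1.
  by case: (c) => k'; [apply: natE | rewrite NegzE mulrNz ffunE natE mulrN].
have m'k : supp_k m' by move=> i ki; rewrite !ffunE ms_c mk // sk // mul0r subr0.
have m'0 : m' i0 = (m i0 %% d)%Z.
  by apply/eqP; rewrite !ffunE ms_c def_d subr_eq addrC mulrC def_m.
have {}m'0 : m' i0 = 0.
  apply/eqP; rewrite m'0; case: (posnP `|(m i0 %% d)%Z|%N) => [/eqP|mod_gt0].
    by rewrite absz_eq0.
  have : D `|(m i0 %% d)%Z|%N.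
    split=> //; exists m', y'; split=> //.
    by rewrite m'0 gez0_abs ?modz_ge0.
  move/min_d; rewrite leqNgt => /negP[].
  rewrite -ltz_nat gez0_abs ?modz_ge0 //.
  by rewrite ltz_pmod.
have ev_m' : lmon x' m' = y'.
  rewrite lmon_x' m'0 expr0z mul1r -(xR _ _ Rm' (suppS _ m'k m'0)).
  by rewrite /lmon [RHS](bigD1 i0) //= m'0 expr0z mul1r.
have ev_ms : lmon x' ms = ys.
  by rewrite lmon_x' def_d -exprnP zd divfK.
have -> : m = m' + ms *~ c by rewrite subrK.
by rewrite lmonD // lmonMz // ev_m' ev_ms divfK // expfz_neq0 // (Rn0 _ _ Rs).
Qed.

End Torus.

(** * Closed domains of diagonal matrices *)

Section DiagonalDomain.

(** [T] stands for the diagonals of the elements of a closed subalgebra that are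
    diagonal in a fixed basis, when the subalgebra has unit the projection on
    the coordinates in [S] and maps to a field with nil kernel. *)
Variables (K : closedFieldType) (n : nat) (S : pred 'I_n).
Variable T : ('I_n -> K) -> Prop.

Hypothesis T1 : T (fun i => (i \in S)%:R).
Hypothesis TB : forall f h, T f -> T h -> T (fun i => f i - h i).
Hypothesis TM : forall f h, T f -> T h -> T (fun i => f i * h i).
Hypothesis T_domain :
  forall f i, T f -> i \in S -> f i = 0 -> forall j, f j = 0.
Hypothesis T_closed : forall x,
  (forall P : {mpoly K[n]}, (forall f, T f -> P.@[f] = 0) -> P.@[x] = 0) -> T x.
Hypothesis T_infinite :
  forall i, i \in S -> forall s : seq K, exists2 f, T f & f i \notin s.

Definition mon (f : 'I_n -> K) (m : 'X_{1..n}) : K := \prod_i f i ^+ m i.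

Lemma domain0 : T (fun=> 0).
Proof.
apply: T_closed => P TP; rewrite -[RHS](TP _ (TB T1 T1)).
by apply: meval_eq => i; rewrite subrr.
Qed.

Lemma domain_ext f h : f =1 h -> T f -> T h.
Proof.
move=> fh Tf; apply: T_closed => P TP; rewrite -[RHS](TP _ Tf).
by apply: meval_eq => i; rewrite fh.
Qed.

Lemma domainD f h : T f -> T h -> T (fun i => f i + h i).
Proof.
move=> Tf Th; apply: domain_ext (TB Tf (TB domain0 Th)) => i.
by rewrite sub0r opprK.
Qed.

Lemma domain_neq0 f i j : T f -> i \in S -> j \in S -> f i != 0 -> f j != 0.
Proof.
by move=> Tf Si Sj; apply: contraNneq => fj0; rewrite (T_domain Tf Sj fj0).
Qed.

Definition supported (m : 'X_{1..n}) := [forall (i | i \notin S), m i == 0%N].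

Lemma mon_supported f m : supported m ->
  mon f m = \prod_(i | i \in S) f i ^+ m i.
Proof.
move=> /forall_inP m_supp; rewrite /mon (bigID (mem S)) /=.
by rewrite [X in _ * X]big1 ?mulr1 // => i /m_supp/eqP ->.
Qed.

Lemma mon_unsupported f m : (forall i, i \notin S -> f i = 0) -> ~~ supported m ->
  mon f m = 0.
Proof.
move=> f_supp /forall_inPn[i Si mi].
by rewrite /mon (bigD1 i) //= f_supp // expr0n (negPf mi) mul0r.
Qed.

Lemma mon_one m : mon (fun i => (i \in S)%:R) m = (supported m)%:R.
Proof.
have [m_supp|m_supp] := boolP (supported m); last first.
  by apply: mon_unsupported => // i /negPf ->.
by rewrite mon_supported // big1 // => i ->; rewrite expr1n.
Qed.

(** The monomials are multiplicative on [T], so the polynomials that vanish on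
    [T] are combinations of differences of monomials that agree on [T]. *)
Lemma domain_mem_monomial x : (forall i, i \notin S -> x i = 0) ->
  (forall m m', supported m -> supported m' ->
     (forall f, T f -> mon f m = mon f m') -> mon x m = mon x m') ->
  T x.
Proof.
move=> x_supp x_mon; apply: T_closed => P TP; rewrite mevalE.
pose X := {f : 'I_n -> K | T f}.
pose mulX (f h : X) : X := exist _ _ (TM (proj2_sig f) (proj2_sig h)).
apply: (@multiplicative_relation _ _ X mulX (exist _ _ T1)
          (fun m f => mon (proj1_sig f) m)).
- by move=> m f h; rewrite /mon -big_split; apply: eq_bigr => i _; rewrite exprMn.
- move=> m /=; rewrite mon_one; have [_|m_supp] := boolP (supported m); [by left|].
  by right; apply: mon_unsupported.
- move=> m m' eq_mm'; have := eq_mm' (exist _ _ T1); rewrite /= !mon_one.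
  have [m_supp|m_supp] := boolP (supported m); last first.
    have [_ /eqP|m'_supp _] := boolP (supported m').
      by rewrite eq_sym oner_eq0.
    by rewrite -!/(mon x _) !mon_unsupported.
  have [m'_supp _|_ /eqP] := boolP (supported m'); last by rewrite oner_eq0.
  by apply: x_mon => // f Tf; apply: (eq_mm' (exist _ f Tf)).
- by move=> [f Tf] /=; rewrite -[RHS](TP f Tf) mevalE.
Qed.

(** The lattice of multiplicative relations between the coordinates of the
    nonzero members of [T]. *)
Definition mrel (m : {ffun 'I_n -> int}) : Prop :=
  forall f, T f -> (forall i, i \in S -> f i != 0) ->
  \prod_(i | i \in S) f i ^ m i = 1.

Lemma mrel0 : mrel 0.
Proof. by move=> f _ _; rewrite big1 // => i _; rewrite ffunE expr0z. Qed.

Lemma mrelB m m' : mrel m -> mrel m' -> mrel (m - m').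
Proof.
move=> tm tm' f Tf f0; rewrite (eq_bigr (fun i => f i ^ m i / f i ^ m' i)).
  by rewrite prodf_div tm // tm' // divr1.
by move=> i Si; rewrite !ffunE expfzDr ?f0 // -invr_expz.
Qed.

(** Two monomials supported in [S] agree on [T] exactly when the difference of
    their exponents is a relation, so a point of the torus that satisfies the
    relations satisfies all the binomial equations of [T]. *)
Lemma domain_mem_torus (x : 'I_n -> K) : (forall i, x i != 0) ->
  (forall m, mrel m -> lmon x m = 1) -> T (fun i => (i \in S)%:R * x i).
Proof.
move=> x0 x_tors; apply: domain_mem_monomial => [i /negPf ->|m m' m_supp m'_supp eq_mm'].
  by rewrite mul0r.
have one_x m1 : supported m1 ->
    mon (fun i => (i \in S)%:R * x i) m1 = lmon x [ffun i => (m1 i)%:Z].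
  move=> m1_supp; rewrite /mon; under eq_bigr do rewrite exprMn.
  rewrite big_split /= -/(mon (fun i => (i \in S)%:R) m1) mon_one m1_supp mul1r.
  by apply: eq_bigr => i _; rewrite ffunE exprnP.
rewrite !one_x //; apply: divr1_eq; rewrite -lmonN -lmonD //; apply: x_tors.
move=> f Tf f0; have := eq_mm' f Tf; rewrite !mon_supported // => eqf.
rewrite (eq_bigr (fun i => f i ^+ m i / f i ^+ m' i)).
  by rewrite prodf_div eqf divff //; apply/prodf_neq0 => i Si; rewrite expf_neq0 ?f0.
by move=> i Si; rewrite !ffunE expfzDr ?f0 // -invr_expz.
Qed.

Definition unit_exp (i : 'I_n) : {ffun 'I_n -> int} := [ffun j => (j == i)%:Z].

Lemma lmon_unit (x : 'I_n -> K) i (c : int) :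
  (forall i, x i != 0) -> lmon x (unit_exp i *~ c) = x i ^ c.
Proof.
move=> x0; rewrite lmonMz // /lmon (bigD1 i) //= ffunE eqxx big1 ?mulr1 //.
by move=> j /negPf ji; rewrite ffunE ji expr0z.
Qed.

Lemma mrelN m : mrel m -> mrel (- m).
Proof. by move=> tm; rewrite -sub0r; apply: mrelB => //; apply: mrel0. Qed.

Lemma mrelD m m' : mrel m -> mrel m' -> mrel (m + m').
Proof. by move=> tm /mrelN tm'; rewrite -[m']opprK; apply: mrelB. Qed.

Lemma mrelMz m c : mrel m -> mrel (m *~ c).
Proof.
move=> tm; have natP k : mrel (m *+ k).
  by elim: k => [|k IHk]; [apply: mrel0 | rewrite mulrS; apply: mrelD].
by case: c => k; [apply: natP | rewrite NegzE mulrNz; apply/mrelN/natP].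
Qed.

(** A character of [Z^n] that is trivial on the relations of [T] is a point
    of [T].  If it could be [1] at [i] and not at [j], then subtracting the
    unit of [T] would give a nonzero member of [T] vanishing at [i]. *)
Lemma domain_rigid i j (zeta : K) : i \in S -> j \in S -> zeta != 0 ->
  (forall a b, mrel (unit_exp i *~ a + unit_exp j *~ b) -> zeta ^ b = 1) ->
  zeta = 1.
Proof.
move=> Si Sj z0 z_tors.
pose R m y := exists a b, mrel (m - (unit_exp i *~ a + unit_exp j *~ b)) /\
                          y = zeta ^ b.
have [|m y m' y'|m y|y|x x0 xR] := @extend_character _ _ R.
- by exists 0, 0; rewrite !mulr0z addr0 subr0; split=> //; apply: mrel0.
- move=> [a [b [t ->]]] [a' [b' [t' ->]]]; exists (a - a'), (b - b').
  split; last by rewrite expfzDr // -invr_expz.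
  have -> : unit_exp i *~ (a - a') + unit_exp j *~ (b - b') =
      (unit_exp i *~ a + unit_exp j *~ b) - (unit_exp i *~ a' + unit_exp j *~ b').
    by rewrite !mulrzBr opprD addrACA.
  have := mrelB t t'; rewrite !opprB [X in mrel (_ + X)]addrC addrACA.
  by rewrite (addrC (- _)).
- by move=> [a [b [_ ->]]]; apply: expfz_neq0.
- move=> [a [b [t ->]]]; apply: (z_tors a); rewrite -[_ + _]opprK; apply: mrelN.
  by rewrite -sub0r.
have x_tors m : mrel m -> lmon x m = 1.
  by move=> tm; apply: xR; exists 0, 0; rewrite !mulr0z addr0 subr0.
have xi : x i = 1.
  rewrite -[x i]expr1z -lmon_unit //; apply: xR; exists 1, 0.
  by rewrite mulr0z addr0 subrr; split=> //; apply: mrel0.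
have xj : x j = zeta.
  rewrite -[x j]expr1z -lmon_unit //; apply: xR; exists 0, 1.
  by rewrite mulr0z add0r subrr; split=> //; apply: mrel0.
have := T_domain (TB (domain_mem_torus x0 x_tors) T1) Si.
rewrite Si xi mul1r subrr => /(_ (erefl _) j)/eqP.
by rewrite Sj xj mul1r subr_eq0 => /eqP.
Qed.

Variables (p : nat) (pchK : p \in [pchar K]).

(** Let [d] generate the group of the [b] for which some [(a, b)] is a relation
    between the coordinates [i] and [j].  Unless [d] is a power of [p] there is
    a [d]-th root of unity other than [1] (any nonzero element of [K] if there is
    no relation), which [domain_rigid] forbids.  Hence a [p]-power of the
    coordinate [j] is an integral power of the coordinate [i], whose exponent is
    a power of [p] because coordinates are additive on [T]. *)
Lemma domain_coords_related i j : i \in S -> j \in S ->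
  exists a b, forall f, T f -> f i ^+ (p ^ a) = f j ^+ (p ^ b).
Proof.
move=> Si Sj; have p_pr := pcharf_prime pchK.
pose D d := (0 < d)%N /\ exists a : int, mrel (unit_exp i *~ a + unit_exp j *~ d).
have Dabs a (b : int) : b != 0 -> mrel (unit_exp i *~ a + unit_exp j *~ b) ->
    D `|b|%N.
  move=> b0 tb; split; first by rewrite lt0n absz_eq0.
  case: b {b0} tb => b tb; first by exists a.
  by exists (- a); rewrite NegzE in tb; have := mrelN tb; rewrite opprD -!mulrNz opprK.
have [[d0 Dd0]|noD] := classic (exists d, D d); last first.
  have [zeta] := closed_field_infinite [:: 0; 1 : K].
  rewrite !inE negb_or => /andP[z0 /eqP[]]; apply: (domain_rigid Si Sj z0) => a b tb.
  have [->|b0] := eqVneq b 0; first by rewrite expr0z.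
  by case: noD; exists `|b|%N; apply: Dabs tb.
have [d [d_gt0 [a0 ta0]] min_d] := least_nat (ex_intro _ d0 Dd0).
have d_dvd a (b : int) : mrel (unit_exp i *~ a + unit_exp j *~ b) -> (d %| b)%Z.
  move=> tb; have d_neq0 : d%:Z != 0 by case: (d) d_gt0.
  apply/dvdz_mod0P/eqP; apply: contraT => mod_neq0.
  have tmod : mrel (unit_exp i *~ (a - a0 * (b %/ d)%Z) + unit_exp j *~ (b %% d)%Z).
    have -> : (b %% d)%Z = b - d%:Z * (b %/ d)%Z.
      by rewrite {2}(divz_eq b d) mulrC addrAC subrr add0r.
    have := mrelB tb (mrelMz (b %/ d)%Z ta0).
    by rewrite mulrzDl -!mulrzA !mulrzBr opprD addrACA.
  have := min_d _ (Dabs _ _ mod_neq0 tmod).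
  by rewrite leqNgt -ltz_nat gez0_abs ?modz_ge0 // ltz_pmod.
have [d' pd' def_d] := pfactor_coprime p_pr d_gt0.
have d'1 : d' = 1%N.
  apply: NNPP => d'_neq1.
  have d'_gt1 : (1 < d')%N.
    case: d' d'_neq1 def_d {pd'} => [|[|d']] // _ def_d.
    by rewrite def_d mul0n in d_gt0.
  have [|zeta] := closed_rootP (\poly_(k < d') (1 : K)) _.
    by rewrite size_poly_eq ?oner_neq0 // gtn_eqF.
  rewrite rootE horner_poly => /eqP sum0.
  have {}sum0 : \sum_(k < d') zeta ^+ k = 0.
    by rewrite -[RHS]sum0; apply: eq_bigr => k _; rewrite mul1r.
  have zeta_d' : zeta ^+ d' = 1.
    by apply/eqP; rewrite -subr_eq0 subrX1 sum0 mulr0.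
  have z0 : zeta != 0.
    apply: contra_eq_neq zeta_d' => ->.
    by rewrite expr0n gtn_eqF ?(ltnW d'_gt1) // eq_sym oner_eq0.
  have zeta1 : zeta = 1.
    apply: (domain_rigid Si Sj z0) => a b /d_dvd/dvdzP[c ->].
    by rewrite def_d PoszM mulrC -mulrA -exprz_exp -exprnP zeta_d' exp1rz.
  have : d'%:R = 0 :> K.
    rewrite -[RHS]sum0 zeta1; under eq_bigr do rewrite expr1n.
    by rewrite sumr_const card_ord.
  move/eqP; rewrite -(dvdn_pcharf pchK) => p_dvd.
  by have := coprime_dvdr p_dvd pd'; rewrite /coprime gcdnn => /eqP p1; rewrite p1 in p_pr.
rewrite d'1 mul1n in def_d; set e := logn p d in def_d.
have powj f : T f -> (forall i, i \in S -> f i != 0) ->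
    f j ^+ (p ^ e) = f i ^ (- a0).
  move=> Tf f0; pose x k := if k \in S then f k else 1.
  have x0 k : x k != 0 by rewrite /x; case: ifP => [/f0 //|_]; apply: oner_neq0.
  have : lmon x (unit_exp i *~ a0 + unit_exp j *~ d) = 1.
    rewrite -[RHS](ta0 f Tf f0) [RHS]big_mkcond; apply: eq_bigr => k _.
    by rewrite /x; case: ifP => // _; rewrite exp1rz.
  rewrite lmonD // !lmon_unit // /x Si Sj -exprnP def_d => eq1.
  by rewrite -invr_expz -[RHS]mulr1 -eq1 mulKf // expfz_neq0 // f0.
have [b def_a0] : exists b, - a0 = (p ^ b)%N.
  apply: (additive_expz pchK) => s.
  (* The values 0 and -1 are avoided so that both f and f + 1 are nonzero. *)
  have [f Tf] := T_infinite Si [:: 0, -1 & s].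
  rewrite !inE !negb_or => /and3P[fi0 fi1 fs]; exists (f i).
  rewrite -subr_eq0 opprK in fi1; split=> //.
  have f_neq0 k : k \in S -> f k != 0 by move=> Sk; apply: domain_neq0 fi0.
  have Tf1 := domainD Tf T1; have := powj _ Tf1; rewrite Si Sj exp_pcharD // expr1n.
  rewrite powj // => -> // k Sk.
  by apply: (domain_neq0 Tf1 Si Sk); rewrite Si.
exists b, e => f Tf; have [fi0|fi0] := eqVneq (f i) 0.
  by rewrite fi0 (T_domain Tf Si fi0) !expr0n !expn_eq0 !(gtn_eqF (prime_gt0 p_pr)).
rewrite powj ?def_a0 // => k Sk.
exact: domain_neq0 fi0.
Qed.

(** After raising to a common power, each coordinate is a power of the
    coordinate [i0], so that every relation between monomials holds along the
    curve below. *)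
Lemma domain_frobenius_curve i0 : i0 \in S -> exists w : 'I_n -> nat,
  forall b, T (fun i => (i \in S)%:R * b ^+ (p ^ w i)).
Proof.
move=> S0; have rel i : exists ab : nat * nat, i \in S ->
    forall f, T f -> f i ^+ (p ^ ab.1) = f i0 ^+ (p ^ ab.2).
  have [Si|nSi] := boolP (i \in S); last by exists (0, 0)%N.
  by have [a [b ab]] := domain_coords_related Si S0; exists (a, b).
have [ab abP] := fin_all_exists rel.
pose N := (\sum_i (ab i).1)%N; pose w i := ((ab i).2 + (N - (ab i).1))%N.
have wP f i : T f -> i \in S -> f i ^+ (p ^ N) = f i0 ^+ (p ^ w i).
  move=> Tf Si; have leN : ((ab i).1 <= N)%N by rewrite /N (bigD1 i) //= leq_addr.
  by rewrite -(subnKC leN) expnD exprM abP // -exprM -expnD.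
exists w => b; apply: domain_mem_monomial => [i /negPf ->|m m' m_supp m'_supp eq_mm'].
  by rewrite mul0r.
pose wt (m1 : 'X_{1..n}) := (\sum_(i | i \in S) p ^ w i * m1 i)%N.
have mon_b m1 : supported m1 ->
    mon (fun i => (i \in S)%:R * b ^+ (p ^ w i)) m1 = b ^+ wt m1.
  move=> m1_supp; rewrite mon_supported // -prodrXr; apply: eq_bigr => i ->.
  by rewrite mul1r exprM.
have mon_f f m1 : T f -> supported m1 -> mon f m1 ^+ (p ^ N) = f i0 ^+ wt m1.
  move=> Tf m1_supp; rewrite mon_supported // -prodrXr -prodrXl.
  by apply: eq_bigr => i Si; rewrite exprAC wP // exprM.
rewrite !mon_b //; congr (_ ^+ _); apply/eqP.
have P0 : 'X^(wt m) - 'X^(wt m') = 0 :> {poly K}.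
  apply: poly0_of_roots => s; have [f Tf fs] := T_infinite S0 s.
  exists (f i0) => //; rewrite rootE !hornerE -!mon_f // eq_mm' //.
  by rewrite subrr.
have [//|/negPf neq_wt] := eqVneq (wt m) (wt m').
have := congr1 (fun Q : {poly K} => Q`_(wt m)) P0.
by rewrite coefB !coefXn eqxx neq_wt coef0 subr0 => /eqP; rewrite oner_eq0.
Qed.

End DiagonalDomain.

(** * Finite fields *)

Lemma finfield_card_pow (F : finFieldType) :
  exists p f, [/\ p \in [pchar F], (0 < f)%N & #|F| = (p ^ f)%N].
Proof.
have [p p_pr pchF] := finPcharP F.
exists p, (logn p #|pPrimeCharType pchF|); split=> //; last first.
  exact: (card_pprimeChar pchF).
rewrite lt0n; apply: contraTneq (finNzRing_gt1 F) => f0.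
have -> : #|F| = #|pPrimeCharType pchF| by [].
by rewrite (card_pprimeChar pchF) f0.
Qed.

Section FiniteField.

Variables (F : fieldType) (q : nat) (s : seq F).
Hypotheses (uniq_s : uniq s) (mem_s : forall x, x \in s) (size_s : q = size s).

Lemma finite_field_structure : (forall x : F, x ^+ q = x) /\
  exists p f, [/\ p \in [pchar F], (0 < f)%N & q = (p ^ f)%N].
Proof.
pose unpickle i := nth None [seq Some x | x <- s] i.
have pickleK : pcancel (fun x => index x s) unpickle.
  move=> x; rewrite /unpickle (nth_map x) ?index_mem ?mem_s //.
  by rewrite nth_index ?mem_s.
have enumP : Finite.axiom s by move=> x; rewrite count_uniq_mem ?mem_s.
pose countF := isCountable.Build F pickleK.
pose finF : finFieldType := HB.pack F countF (isFinite.Build F enumP).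
have -> : q = #|finF| by rewrite cardT enumT unlock size_s.
split; first exact: (@expf_card finF).
exact: (finfield_card_pow finF).
Qed.

(** If [q = p^f], then the power [p^(e mod f)] is also trivial on [F], but
    [X^(p^r) - X] has fewer than [q] roots for [0 < r < f]. *)
Lemma fixed_power_card p e : p \in [pchar F] ->
  (forall x : F, x ^+ (p ^ e) = x) -> exists d, (p ^ e)%N = (q ^ d)%N.
Proof.
move=> pchF fix_e; have p_pr := pcharf_prime pchF.
have [fermat [p' [f [pchF' f_gt0 def_q]]]] := finite_field_structure.
have def_p' : p' = p.
  apply/eqP; rewrite eq_sym -dvdn_prime2 ?(pcharf_prime pchF') //.
  by rewrite (dvdn_pcharf pchF) pcharf0.
rewrite {p' pchF'}def_p' in def_q.
have fix_f k (x : F) : x ^+ (p ^ (k * f)) = x.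
  elim: k => [|k IHk]; first by rewrite mul0n expn0 expr1.
  by rewrite mulSn expnD exprM -def_q fermat.
have fix_r (x : F) : x ^+ (p ^ (e %% f)) = x.
  by rewrite -[RHS]fix_e {2}(divn_eq e f) expnD exprM fix_f.
exists (e %/ f)%N; rewrite {1}(divn_eq e f) def_q -expnM mulnC.
have [->|r_gt0] := posnP (e %% f); first by rewrite addn0.
pose P : {poly F} := 'X^(p ^ (e %% f)) - 'X.
have size_P : size P = (p ^ (e %% f)).+1.
  rewrite /P size_polyDl size_polyXn // size_polyN size_polyX ltnS.
  exact: leq_ltn_trans r_gt0 (ltn_expl _ (prime_gt1 p_pr)).
have P0 : P != 0 by rewrite -size_poly_eq0 size_P.
have rootP : all (root P) s.
  by apply/allP => x _; rewrite rootE !hornerE fix_r subrr.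
have := max_poly_roots P0 rootP uniq_s; rewrite -size_s def_q size_P ltnS.
by rewrite leqNgt ltn_exp2l ?prime_gt1 // ltn_mod f_gt0.
Qed.

End FiniteField.

(** * Diagonalization of large powers of the characteristic *)

Section Diagonalization.

Variables (K : fieldType) (n : nat).

Definition dg (g : 'M[K]_n) (f : 'I_n -> K) : 'M[K]_n :=
  invmx g *m diag_mx (\row_i f i) *m g.

Lemma codiagonalizable_dg (s : seq 'M[K]_n) : codiagonalizable s ->
  exists2 g, g \in unitmx & forall x, x \in s -> exists f, x = dg g f.
Proof.
move=> [g ug /allP diag_s]; exists g => // x xs.
have /(diagonalizable_forLR ug)[d ->] := diag_s x xs.
exists (fun i => d 0 i); rewrite mxpoly.conjVmx // /dg; congr (_ *m diag_mx _ *m _).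
by apply/rowP=> i; rewrite mxE.
Qed.

End Diagonalization.

Lemma diagonalizable_annihilated (K : fieldType) n (x : 'M[K]_n.+1) (s : seq K) :
  uniq s -> horner_mx x (\prod_(r <- s) ('X - r%:P)) = 0 -> diagonalizable x.
Proof.
move=> us xs; apply/diagonalizableP; exists s => //.
exact: mxminpoly_min.
Qed.

Lemma idempotent_diagonalizable (K : fieldType) n (x : 'M[K]_n) :
  x *m x = x -> diagonalizable x.
Proof.
case: n x => [|n] x xx; first by rewrite [x]thinmx0; apply: diagonalizable0.
apply: (@diagonalizable_annihilated _ _ _ [:: 0; 1]).
  by rewrite /= inE eq_sym oner_eq0.
rewrite big_cons big_seq1 rmorphM /= !rmorphB /= !horner_mx_X !horner_mx_C.
by rewrite raddf0 subr0 mulrBr mulr1 -mulmxE xx subrr.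
Qed.

(** The [p^n]-th power makes the multiplicity of every eigenvalue harmless: it
    is at most [n <= p^n]. *)
Lemma pchar_power_diagonalizable (K : closedFieldType) p n (x : 'M[K]_n) :
  p \in [pchar K] -> diagonalizable (x ^+ (p ^ n)).
Proof.
move=> pchK; have p_pr := pcharf_prime pchK.
case: n x => [|n] x; first by rewrite [_ ^+ _]thinmx0; apply: diagonalizable0.
have [r def_r] := closed_field_poly_normal (char_poly x).
rewrite (monicP (char_poly_monic x)) scale1r in def_r.
have size_r : size r = n.+1.
  by have := size_char_poly x; rewrite def_r size_prod_XsubC => -[].
pose pe := (p ^ n.+1)%N.
apply: (@diagonalizable_annihilated _ _ _ [seq a ^+ pe | a <- undup r]).
  by rewrite map_inj_uniq ?undup_uniq //; apply: exp_pchar_inj.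
have -> : horner_mx (x ^+ pe) (\prod_(a <- [seq a ^+ pe | a <- undup r]) ('X - a%:P))
    = horner_mx x ((\prod_(a <- undup r) ('X - a%:P)) ^+ pe).
  rewrite big_map -prodrXl !rmorph_prod; apply: eq_bigr => a _ /=.
  have pch_poly : p \in [pchar {poly K}] by rewrite pchar_poly.
  have -> : ('X - a%:P) ^+ pe = 'X^pe - (a ^+ pe)%:P.
    by rewrite exprDn_pchar ?exprNn_pchar ?pnatX ?pnatE ?pch_poly // rmorphXn.
  rewrite !rmorphB /=; congr (_ - _); last by rewrite !horner_mx_C.
  by rewrite horner_mx_X rmorphXn /= horner_mx_X.
have [Q def_Q] : exists Q, (\prod_(a <- undup r) ('X - a%:P)) ^+ pe = Q * char_poly x.
  apply/dvdpP; apply: (@dvdp_trans _ ((\prod_(a <- undup r) ('X - a%:P)) ^+ n.+1)).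
    rewrite def_r -size_r; move: (undup r) (mem_undup r) => r1 r1P.
    have {r1P} : {subset r <= r1} by move=> a; rewrite r1P.
    elim: (r) => [|a r' IHr] sub_r'; first by rewrite big_nil dvd1p.
    rewrite big_cons exprS dvdp_mul //.
      by rewrite dvdp_XsubCl root_prod_XsubC sub_r' ?mem_head.
    by apply: IHr => b br'; apply: sub_r'; rewrite inE br' orbT.
  by apply: dvdp_exp2l; apply: ltnW; apply: ltn_expl; apply: prime_gt1.
by rewrite def_Q rmorphM /= Cayley_Hamilton mulr0.
Qed.

(** * Embeddings of finite fields *)

Definition frobenius_related (K : fieldType) (X : Type) (q : nat)
    (s1 s2 : X -> K) : Prop :=
  exists d, (forall y, s1 y = s2 y ^+ (q ^ d)) \/ (forall y, s2 y = s1 y ^+ (q ^ d)).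

Lemma finite_field_generator (L : fieldType) (s : seq L) :
  uniq s -> (forall x, x \in s) -> exists z, forall x : L, x != 0 -> exists i, x = z ^+ i.
Proof.
move=> us mem_s; have [fermat _] := finite_field_structure us mem_s (erefl _).
pose r := rem 0 s.
have size_r : size s = (size r).+1.
  by rewrite size_rem ?mem_s // prednK // -has_predT; apply/hasP; exists 0; rewrite ?mem_s.
have r_root (x : L) : x != 0 -> x ^+ size r = 1.
  move=> x0; apply: (mulfI x0); rewrite mulr1 -exprS -size_r; exact: fermat.
have [||||z _ z_prim] := hasP (@has_prim_root L (size r) r _ _ _ _).
- have : 1 \in r by rewrite mem_rem_uniq // !inE oner_neq0 mem_s.
  by case: (r).
- apply/allP=> x; rewrite mem_rem_uniq // !inE => /andP[x0 _].
  by rewrite unity_rootE r_root.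
- exact: rem_uniq.
- by [].
by exists z => x /r_root/(prim_rootP z_prim)[i ->]; exists i.
Qed.

(** The minimal polynomial of a generator [z] divides the product of the
    [X - z^(q^j)] over the Frobenius orbit of [z], which has coefficients
    in [F]; hence every embedding maps [z] to a Frobenius conjugate. *)
Lemma finite_embeddings_related (F L : fieldType) (K : fieldType) q
    (alpha : {rmorphism F -> L}) (s1 s2 : {rmorphism L -> K})
    (sF : seq F) (sL : seq L) :
  uniq sF -> (forall x, x \in sF) -> q = size sF ->
  uniq sL -> (forall x, x \in sL) ->
  (forall c, s1 (alpha c) = s2 (alpha c)) -> frobenius_related q s1 s2.
Proof.
move=> uF memF def_q uL memL eq_s.
have [fermatF [p [f [pchF f_gt0 def_pf]]]] := finite_field_structure uF memF def_q.
have p_pr := pcharf_prime pchF.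
have pchL : p \in [pchar L] := rmorph_pchar alpha pchF.
have qM : [pchar L].-nat q by rewrite def_pf pnatX pnatE ?pchL.
have [z zP] := finite_field_generator uL memL.
have [Fr FrE] : exists Fr : {rmorphism L -> L}, forall x, Fr x = x ^+ q.
  pose fr (x : L) := x ^+ q.
  have frB : zmod_morphism fr by move=> x y; rewrite /fr exprDn_pchar ?exprNn_pchar.
  have frM : monoid_morphism fr by split=> [|x y]; rewrite /fr ?expr1n ?exprMn.
  pose Fr : {rmorphism L -> L} := HB.pack fr
    (GRing.isZmodMorphism.Build _ _ fr frB) (GRing.isMonoidMorphism.Build _ _ fr frM).
  by exists Fr.
have iterFr j (x : L) : iter j Fr x = x ^+ (q ^ j).
  by elim: j => [|j IHj] //=; rewrite IHj FrE expnSr exprM.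
have Fr_inj : injective Fr := fmorph_inj Fr.
have [m m_gt0 zm] : exists2 m, (0 < m)%N & iter m Fr z = z.
  have [inj_iter|] := classic (injective (fun j => iter j Fr z)).
    have : (size (mkseq (fun j => iter j Fr z) (size sL).+1) <= size sL)%N.
      by apply: uniq_leq_size => [|x _]; rewrite ?mkseq_uniq.
    by rewrite size_mkseq ltnn.
  move/not_all_ex_not=> [a /not_all_ex_not[b ab]].
  have [{}ab neq_ab] := imply_to_and _ _ ab.
  wlog lt_ab : a b ab neq_ab / (a < b)%N.
    move=> IH; have [lt_ab|lt_ba|//] := ltngtP a b; first exact: (IH a b).
    by apply: (IH b a) => // eq_ba; apply: neq_ab.
  exists (b - a)%N; first by rewrite subn_gt0.
  have inj_iter : injective (iter a Fr).
    by elim: (a) => // a' IHa x y /= /Fr_inj/IHa.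
  by apply: inj_iter; rewrite -iterD subnKC // ltnW.
have fixF c : Fr c = c -> exists a, c = alpha a.
  move=> Fr_c; apply: NNPP => no_a.
  pose P : {poly L} := 'X^q - 'X.
  have q_gt1 : (1 < q)%N.
    rewrite def_pf; exact: leq_ltn_trans f_gt0 (ltn_expl _ (prime_gt1 p_pr)).
  have size_P : size P = q.+1.
    by rewrite /P size_polyDl size_polyXn // size_polyN size_polyX ltnS.
  have P0 : P != 0 by rewrite -size_poly_eq0 size_P.
  have rootP : all (root P) (c :: map alpha sF).
    apply/allP => x; rewrite inE => /predU1P[->|/mapP[a _ ->]].
      by rewrite rootE !hornerE -FrE Fr_c subrr.
    by rewrite rootE !hornerE -rmorphXn fermatF subrr.
  suff : (size (c :: map alpha sF) < size P)%N.
    by rewrite /= size_map -def_q size_P ltnn.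
  apply: max_poly_roots P0 rootP _ => /=.
  rewrite map_inj_uniq ?uF ?andbT; last exact: fmorph_inj.
  by apply/mapP => -[a _ def_c]; apply: no_a; exists a.
pose h := \prod_(j < m) ('X - (iter j Fr z)%:P).
have h_fix : map_poly Fr h = h.
  rewrite rmorph_prod /= /h; case: m m_gt0 zm {h} => // m _ zm.
  rewrite big_ord_recr [RHS]big_ord_recl /= [LHS]mulrC; congr (_ * _).
    by rewrite map_polyXsubC -iterS zm.
  by apply: eq_bigr => j _; rewrite map_polyXsubC.
have eq_h : map_poly s1 h = map_poly s2 h.
  apply/polyP => i; rewrite !coef_map.
  have [|a ->] := fixF h`_i; last exact: eq_s.
  by rewrite -[in RHS]h_fix coef_map.
have : root (map_poly s2 h) (s2 z).
  rewrite rmorph_root // /h rootE; case: m m_gt0 {h zm h_fix eq_h} => // m _.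
  by rewrite big_ord_recl /= hornerM hornerXsubC subrr mul0r.
rewrite -eq_h rmorph_prod /=; under eq_bigr do rewrite map_polyXsubC.
rewrite rootE horner_prod prodf_seq_eq0 => /hasP[j _ /=].
rewrite hornerXsubC subr_eq0 => /eqP s2z.
exists j; right=> y; have [->|/zP[i ->]] := eqVneq y 0.
  have q_gt0 : (0 < q)%N by rewrite def_pf expn_gt0 prime_gt0.
  by rewrite !rmorph0 expr0n expn_eq0 gtn_eqF.
by rewrite rmorphXn s2z iterFr !rmorphXn exprAC.
Qed.

(** * Matrices that are diagonal in a given basis *)

Section DiagonalIn.

Variables (K : fieldType) (n : nat) (g : 'M[K]_n).
Hypothesis ug : g \in unitmx.
Implicit Types f h : 'I_n -> K.

Lemma dg_ext f h : f =1 h -> dg g f = dg g h.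
Proof. by move=> fh; congr (_ *m diag_mx _ *m _); apply/rowP=> i; rewrite !mxE. Qed.

Lemma dgD f h : dg g f + dg g h = dg g (fun i => f i + h i).
Proof.
rewrite /dg -mulmxDl -mulmxDr -linearD; congr (_ *m diag_mx _ *m _).
by apply/rowP=> i; rewrite !mxE.
Qed.

Lemma dgZ c f : c *: dg g f = dg g (fun i => c * f i).
Proof.
rewrite /dg scalemxAl scalemxAr -linearZ; congr (_ *m diag_mx _ *m _).
by apply/rowP=> i; rewrite !mxE.
Qed.

Lemma dgB f h : dg g f - dg g h = dg g (fun i => f i - h i).
Proof.
by rewrite -scaleN1r dgZ dgD; apply: dg_ext => i; rewrite mulN1r.
Qed.

Lemma dgM f h : dg g f *m dg g h = dg g (fun i => f i * h i).
Proof.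
rewrite /dg !mulmxA mulmxK // -(mulmxA _ (diag_mx _) (diag_mx _)) mulmx_diag.
by congr (_ *m diag_mx _ *m _); apply/rowP=> i; rewrite !mxE.
Qed.

Lemma dg0 : dg g (fun=> 0) = 0.
Proof.
rewrite /dg (_ : diag_mx _ = 0) ?mulmx0 ?mul0mx //.
by apply/matrixP=> i j; rewrite !mxE mul0rn.
Qed.

Lemma dg1 : dg g (fun=> 1) = 1%:M.
Proof.
rewrite /dg (_ : diag_mx _ = 1%:M) ?mulmx1 ?mulVmx //.
by apply/matrixP=> i j; rewrite !mxE.
Qed.

Lemma dgX f k : dg g f ^+ k = dg g (fun i => f i ^+ k).
Proof.
elim: k => [|k IHk]; first by rewrite expr0 -[LHS]/(1%:M) -dg1.
by rewrite exprS IHk -mulmxE dgM; apply: dg_ext => i; rewrite exprS.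
Qed.

Lemma row_dg i f : row i g *m dg g f = f i *: row i g.
Proof.
rewrite -row_mul /dg !mulmxA mulmxV // mul1mx row_mul row_diag_mx mxE.
by rewrite -scalemxAl -rowE.
Qed.

Lemma row_unit_neq0 i : row i g != 0.
Proof.
apply: contraTneq ug => gi0; rewrite unitmxE unitfE.
rewrite (expand_det_row _ i) big1 ?eqxx // => j _.
by have /rowP/(_ j) := gi0; rewrite !mxE => ->; rewrite mul0r.
Qed.

Lemma dg_inj f h : dg g f = dg g h -> f =1 h.
Proof.
move=> fh i; have /eqP := congr1 (fun x => row i g *m x) fh.
rewrite !row_dg -subr_eq0 -scalerBl scaler_eq0 (negPf (row_unit_neq0 i)) orbF.
by rewrite subr_eq0 => /eqP.
Qed.

Lemma dg_nilpotent f m : dg g f ^+ m = 0 -> f =1 (fun=> 0).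
Proof.
rewrite dgX -dg0 => /dg_inj fm i; have /eqP := fm i.
by rewrite expf_eq0 => /andP[_ /eqP].
Qed.

Lemma dg_span (s : seq 'M[K]_n) : (forall t, t \in s -> exists f, t = dg g f) ->
  forall x, (mxvec x <= mspan s)%MS -> exists f, x = dg g f.
Proof.
move=> diag_s; apply: mspan_ind => //.
- by exists (fun=> 0); rewrite dg0.
- by move=> x y [f ->] [h ->]; exists (fun i => f i + h i); rewrite dgD.
- by move=> c x [f ->]; exists (fun i => c * f i); rewrite dgZ.
Qed.

(** The entries of a matrix that is diagonal in the basis [g] are linear in its
    diagonal. *)
Lemma dg_mpoly (P : {mpoly K[n * n]}) : exists Q : {mpoly K[n]},
  forall f, Q.@[f] = P.@[fun i => mxvec (dg g f) 0 i].
Proof.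
pose lq := [tuple \sum_r (mxvec (invmx g *m delta_mx r r *m g) 0 i) *: 'X_r | i < n * n] :
  (n * n).-tuple {mpoly K[n]}.
exists (P \mPo lq) => f; rewrite comp_mpoly_meval; apply: meval_eq => i.
rewrite tnth_mktuple raddf_sum /=.
have -> : dg g f = \sum_r f r *: (invmx g *m delta_mx r r *m g).
  rewrite /dg diag_mx_sum_delta mulmx_sumr mulmx_suml; apply: eq_bigr => r _.
  by rewrite mxE -scalemxAr -scalemxAl.
rewrite linear_sum summxE; apply: eq_bigr => r _.
by rewrite mevalZ mevalXU linearZ mxE mulrC.
Qed.

Lemma closed_diagonal (A : 'M[K]_n -> Prop) x : zariski_closed A ->
  (forall P : {mpoly K[n]}, (forall f, A (dg g f) -> P.@[f] = 0) -> P.@[x] = 0) ->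
  A (dg g x).
Proof.
move=> [Ps A_Ps] x_closed; apply/A_Ps => P PsP.
have [Q QP] := dg_mpoly P; rewrite -QP; apply: x_closed => f /A_Ps/(_ P PsP).
by rewrite QP.
Qed.

End DiagonalIn.

(** * Infinite sets and roots of unity *)

Lemma injective_unbounded (X Y : eqType) (h : X -> Y) : injective h ->
  ~ (exists s : seq X, forall x, x \in s) -> forall s : seq Y, exists x, h x \notin s.
Proof.
move=> inj_h infX s; apply: NNPP => hs; apply: infX.
have [x0|noX] := classic (inhabited X); last first.
  by exists [::] => x; case: noX.
case: x0 => x0; pose pre y := epsilon (inhabits x0) (fun x => h x = y).
exists [seq pre y | y <- s] => x; apply/mapP; exists (h x).
  by apply: contraT => hx; case: hs; exists x.
by apply: inj_h; rewrite /pre (epsilon_spec (inhabits x0) (fun z => h z = h x)) //; exists x.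
Qed.

Lemma root_of_unity_coprime (L : fieldType) p (y : L) : p \in [pchar L] ->
  y != 0 -> (exists2 k, (0 < k)%N & y ^+ k = 1) ->
  exists k, [/\ (0 < k)%N, coprime p k & y ^+ k = 1].
Proof.
move=> pchL y0 [k k_gt0 yk]; have p_pr := pcharf_prime pchL.
have [k' pk' def_k] := pfactor_coprime p_pr k_gt0.
exists k'; split=> //; first by rewrite lt0n; apply: contraTneq k_gt0 => k'0; rewrite def_k k'0.
by apply: (exp_pchar_inj pchL (e := logn p k)); rewrite -exprM -def_k yk expr1n.
Qed.

(** A root of unity of order [k] prime to [p] is fixed by the power
    [(p^e)^(totient k)], by Euler's theorem. *)
Lemma torsion_perfect (L : fieldType) p e (a : L) : p \in [pchar L] ->
  (a != 0 -> exists2 k, (0 < k)%N & a ^+ k = 1) -> exists b, b ^+ (p ^ e) = a.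
Proof.
move=> pchL a_tors; have p_pr := pcharf_prime pchL.
have [->|a0] := eqVneq a 0.
  by exists 0; rewrite expr0n expn_eq0 (gtn_eqF (prime_gt0 p_pr)).
have [k [k_gt0 pk ak]] := root_of_unity_coprime pchL a0 (a_tors a0).
exists (a ^+ ((p ^ e) ^ (totient k).-1)); rewrite -exprM -expnSr prednK ?totient_gt0 //.
have /Euler_exp_totient : coprime (p ^ e) k by apply: coprimeXl.
by rewrite -(expr_mod _ ak) => ->; rewrite expr_mod.
Qed.


(** * Sections of local corners *)

Section Corner.

Variables (F : fieldType) (K : closedFieldType) (iota : {rmorphism F -> K}).
Variables (n : nat) (A : 'M[K]_n -> Prop).
Hypotheses (hA : subalgebra iota A) (A_closed : zariski_closed A).
Variables (L : fieldType) (alpha : {rmorphism F -> L}).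
Variables (e : 'M[K]_n) (theta : 'M[K]_n -> L).

Definition corner x := [/\ A x, e *m x = x & x *m e = x].

Hypothesis corner_e : corner e.
Hypothesis thetaD : forall x y, corner x -> corner y ->
  theta (x + y) = theta x + theta y.
Hypothesis thetaM : forall x y, corner x -> corner y ->
  theta (x *m y) = theta x * theta y.
Hypothesis thetaZ : forall c x, corner x -> theta (iota c *: x) = alpha c * theta x.
Hypothesis theta_e : theta e = 1.
Hypothesis theta_surj : forall a, exists2 x, corner x & theta x = a.
Hypothesis theta_nil : forall x, corner x -> theta x = 0 ->
  exists m : nat, x ^+ m = 0.

Lemma cornerD x y : corner x -> corner y -> corner (x + y).
Proof.
case: hA => _ subalgD _ _ [Ax ex xe] [Ay ey ye]; split; first exact: subalgD.
  by rewrite mulmxDr ex ey.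
by rewrite mulmxDl xe ye.
Qed.

Lemma cornerM x y : corner x -> corner y -> corner (x *m y).
Proof.
case: hA => _ _ subalgM _ [Ax ex xe] [Ay ey ye]; split; first exact: subalgM.
  by rewrite mulmxA ex.
by rewrite -mulmxA ye.
Qed.

Lemma cornerZ c x : corner x -> corner (iota c *: x).
Proof.
case: hA => _ _ _ subalgZ [Ax ex xe]; split; first exact: subalgZ.
  by rewrite -scalemxAr ex.
by rewrite -scalemxAl xe.
Qed.

Lemma cornerB x y : corner x -> corner y -> corner (x - y).
Proof.
move=> Cx Cy; apply: cornerD => //.
by rewrite -scaleN1r -(rmorphN1 iota); apply: cornerZ.
Qed.

Lemma cornerX x k : (0 < k)%N -> corner x -> corner (x ^+ k).
Proof.
case: k => // k _ Cx; elim: k => [|k IHk] //.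
by rewrite exprS -mulmxE; apply: cornerM.
Qed.

Lemma thetaB x y : corner x -> corner y -> theta (x - y) = theta x - theta y.
Proof.
move=> Cx Cy; rewrite -scaleN1r -(rmorphN1 iota) thetaD //; last exact: cornerZ.
by rewrite thetaZ // rmorphN1 mulN1r.
Qed.

Lemma thetaX x k : (0 < k)%N -> corner x -> theta (x ^+ k) = theta x ^+ k.
Proof.
case: k => // k _ Cx; elim: k => [|k IHk] //.
by rewrite exprS -mulmxE thetaM // ?IHk -?exprS //; apply: cornerX.
Qed.

(** An element of the corner that does not lie over [0] is invertible in the
    corner up to a nilpotent element, so it kills no nonzero row vector of the
    image of [e]. *)
Lemma theta_kernel (v : 'rV[K]_n) x :
  corner x -> v *m e = v -> v != 0 -> v *m x = 0 -> theta x = 0.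
Proof.
move=> Cx ve v0 vx; apply/eqP; apply: contraNT v0 => x0.
have [y Cy ty] := theta_surj (theta x)^-1.
have Cxy := cornerM Cx Cy; have Cnu := cornerB Cxy corner_e.
have [|m num] := theta_nil Cnu.
  by rewrite thetaB // thetaM // ty theta_e mulfV // subrr.
have vnu : v *m (x *m y - e) = - v by rewrite mulmxBr mulmxA vx mul0mx sub0r ve.
have vnuX k : v *m (x *m y - e) ^+ k = (-1) ^+ k *: v.
  elim: k => [|k IHk]; first by rewrite expr0 mulmx1 scale1r.
  by rewrite exprSr -mulmxE mulmxA IHk -scalemxAl vnu exprSr -scalerA scaleN1r.
have /eqP := vnuX m; rewrite num mulmx0 eq_sym scaler_eq0 signr_eq0.
by [].
Qed.

Section Frame.

Variables (g : 'M[K]_n) (S : pred 'I_n).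
Hypotheses (ug : g \in unitmx) (def_e : e = dg g (fun i => (i \in S)%:R)).

Definition diag_corner (f : 'I_n -> K) : Prop := corner (dg g f).

Lemma diag_corner1 : diag_corner (fun i => (i \in S)%:R).
Proof. by rewrite /diag_corner -def_e. Qed.

Lemma diag_cornerB f h : diag_corner f -> diag_corner h -> diag_corner (fun i => f i - h i).
Proof. by rewrite /diag_corner -dgB; apply: cornerB. Qed.

Lemma diag_cornerM f h : diag_corner f -> diag_corner h -> diag_corner (fun i => f i * h i).
Proof. by rewrite /diag_corner -dgM //; apply: cornerM. Qed.

Lemma row_frame i : i \in S -> row i g *m e = row i g.
Proof. by move=> Si; rewrite def_e row_dg // Si scale1r. Qed.

Lemma diag_corner_supp f i : diag_corner f -> i \notin S -> f i = 0.
Proof.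
move=> [_ _]; rewrite def_e dgM // => /(dg_inj ug)/(_ i) <- /negPf ->.
by rewrite mulr0.
Qed.

Lemma diag_corner_theta0 f : diag_corner f -> theta (dg g f) = 0 -> f =1 (fun=> 0).
Proof. by move=> Tf /(theta_nil Tf)[m /(dg_nilpotent ug)]. Qed.

Lemma diag_corner_theta_inj f h : diag_corner f -> diag_corner h ->
  theta (dg g f) = theta (dg g h) -> f =1 h.
Proof.
move=> Tf Th eq_t i; apply/eqP; rewrite -subr_eq0; apply/eqP.
apply: (diag_corner_theta0 (diag_cornerB Tf Th)).
by rewrite -dgB thetaB // eq_t subrr.
Qed.

Lemma diag_corner_domain f i : diag_corner f -> i \in S -> f i = 0 -> forall j, f j = 0.
Proof.
move=> Tf Si fi0; apply: (diag_corner_theta0 Tf).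
apply: (theta_kernel Tf (row_frame Si) (row_unit_neq0 ug i)).
by rewrite row_dg // fi0 scale0r.
Qed.

Lemma diag_corner_closed x :
  (forall P : {mpoly K[n]}, (forall f, diag_corner f -> P.@[f] = 0) -> P.@[x] = 0) ->
  diag_corner x.
Proof.
move=> x_closed; have x_supp i : i \notin S -> x i = 0.
  move=> Si; rewrite -(mevalXU x i); apply: x_closed => f Tf.
  by rewrite mevalXU (diag_corner_supp Tf).
split; last 2 first.
- rewrite def_e dgM //; apply: dg_ext => i.
  by have [_|/x_supp ->] := boolP (i \in S); rewrite ?mul1r ?mul0r.
- rewrite def_e dgM //; apply: dg_ext => i.
  by have [_|/x_supp ->] := boolP (i \in S); rewrite ?mulr1 ?mul0r.
apply: closed_diagonal => // P AP; apply: x_closed => f [Af _ _].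
exact: AP.
Qed.

Lemma frame_neq0 : exists i, i \in S.
Proof.
apply: NNPP => noS; have := thetaB corner_e corner_e.
rewrite (_ : e - e = e) ?theta_e ?subrr => [/eqP|]; first by rewrite oner_eq0.
rewrite def_e -(dg0 g); apply: dg_ext => i.
by have [Si|_] := boolP (i \in S); [case: noS; exists i | ].
Qed.

(** A vector [row i g] in the image of [e], multiplied by the powers of [x],
    satisfies a linear relation over [K].  As [K] is perfect, its coefficients
    are [w i]-th powers [b_k ^+ w i], so the relation comes from a combination
    of powers of [x] whose coefficients lie on the curve.  Its image in [L] is
    a polynomial equation for [theta x] over the image of [K], which is
    algebraically closed. *)
Lemma curve_surjective (w : 'I_n -> nat) : (forall i, (0 < w i)%N) ->
  (forall i (x y : K), (x + y) ^+ w i = x ^+ w i + y ^+ w i) ->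
  (forall b, diag_corner (fun i => (i \in S)%:R * b ^+ w i)) ->
  forall a, exists b, theta (dg g (fun i => (i \in S)%:R * b ^+ w i)) = a.
Proof.
move=> w_gt0 wD curve a; pose c b i := (i \in S)%:R * b ^+ w i : K.
have [Psi PsiE] : exists Psi : {rmorphism K -> L}, forall b, Psi b = theta (dg g (c b)).
  pose psi b := theta (dg g (c b)).
  have wB i (x y : K) : (x - y) ^+ w i = x ^+ w i - y ^+ w i.
    by apply/eqP; rewrite eq_sym subr_eq -wD subrK.
  have psiB : zmod_morphism psi.
    move=> x y; rewrite /psi -thetaB; try exact: curve.
    by rewrite dgB; congr theta; apply: dg_ext => i; rewrite -mulrBr /c wB.
  have psiM : monoid_morphism psi.
    split=> [|x y]; rewrite /psi.
      rewrite -theta_e def_e; congr theta; apply: dg_ext => i.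
      by rewrite /c expr1n mulr1.
    rewrite -thetaM; try exact: curve.
    rewrite dgM //; congr theta; apply: dg_ext => i; rewrite /c exprMn mulrACA.
    by rewrite -natrM mulnbl; case: (i \in S).
  pose Psi : {rmorphism K -> L} := HB.pack psi
    (GRing.isZmodMorphism.Build _ _ psi psiB) (GRing.isMonoidMorphism.Build _ _ psi psiM).
  by exists Psi.
suff [b <-] : exists b, Psi b = a by exists b; rewrite PsiE.
have [x Cx tx] := theta_surj a; have [i Si] := frame_neq0.
pose v := row i g; pose M := \matrix_(k < n.+1) (v *m x ^+ k).
have [gamma gamma0 gammaM] : exists2 gamma : 'rV_n.+1, gamma != 0 & gamma *m M = 0.
  have /rowV0Pn[gamma /sub_kermxP ? ?] : kermx M != 0; last by exists gamma.
  by rewrite kermx_eq0 /row_free ltn_eqF // ltnS rank_leq_col.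
have /fin_all_exists[beta betaE] (k : 'I_n.+1) : exists b, b ^+ w i = gamma 0 k.
  exact: closed_root_exists (w_gt0 i).
pose P := \sum_(k < n.+1) beta k *: 'X^k.
have P0 : P != 0.
  apply: contraNneq gamma0 => P0; apply/eqP/rowP=> k; rewrite -betaE mxE.
  have /eqP := congr1 (fun Q : {poly K} => Q`_k) P0.
  rewrite /P coef_sum (bigD1 k) //= coefZ coefXn eqxx mulr1 big1 => [|j /negPf jk].
    by rewrite addr0 coef0 => /eqP ->; rewrite expr0n gtn_eqF.
  by rewrite coefZ coefXn eq_sym (inj_eq val_inj) jk mulr0.
pose z k := dg g (c (beta k)) *m x ^+ k.
have Cz k : corner (z k) /\ theta (z k) = Psi (beta k) * a ^+ k.
  case: k => [[|k] lt_k]; rewrite /z /= PsiE.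
    by rewrite expr0 mulmx1 mulr1; split=> //; apply: curve.
  split; first by apply: cornerM; [apply: curve | apply: cornerX].
  by rewrite thetaM ?thetaX ?tx //; [apply: curve | apply: cornerX].
have Csum (r : seq 'I_n.+1) : corner (\sum_(k <- r) z k) /\
    theta (\sum_(k <- r) z k) = \sum_(k <- r) theta (z k).
  elim: r => [|k r [IHr IHt]].
    rewrite !big_nil -(subrr e); split; first exact: cornerB.
    by rewrite thetaB // subrr.
  have [Czk _] := Cz k; rewrite !big_cons; split; first exact: cornerD.
  by rewrite thetaD // IHt.
have rootP : root (map_poly Psi P) a.
  rewrite rootE rmorph_sum /= horner_sum; apply/eqP.
  have [Cs ts] := Csum (index_enum _).
  transitivity (theta (\sum_k z k)).
    rewrite ts; apply: eq_bigr => k _; rewrite map_polyZ map_polyXn.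
    by rewrite hornerZ hornerXn; case: (Cz k) => _ ->.
  apply: (theta_kernel Cs (row_frame Si) (row_unit_neq0 ug i)).
  rewrite mulmx_sumr -[RHS]gammaM mulmx_sum_row; apply: eq_bigr => k _.
  by rewrite /z mulmxA row_dg // /c Si mul1r betaE rowK scalemxAl.
have [r def_P] := closed_field_poly_normal P.
move: rootP; rewrite def_P map_polyZ rmorph_prod /= rootZ ?fmorph_eq0 ?lead_coef_eq0 //.
under eq_bigr do rewrite map_polyXsubC.
rewrite rootE horner_prod prodf_seq_eq0 => /hasP[b _ /=].
by rewrite hornerXsubC subr_eq0 => /eqP ->; exists b.
Qed.

End Frame.

Lemma frame_of_diagonal (g : 'M[K]_n) f : g \in unitmx -> e = dg g f ->
  exists S : pred 'I_n, e = dg g (fun i => (i \in S)%:R).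
Proof.
move=> ug def_e; have [_ ee _] := corner_e.
exists [pred i | f i == 1]; rewrite def_e; apply: dg_ext => i; rewrite inE.
move: ee; rewrite def_e dgM // => /(dg_inj ug)/(_ i)/eqP.
rewrite -subr_eq0 -{3}[f i]mulr1 -mulrBr mulf_eq0 subr_eq0.
by have [->|_] := eqVneq (f i) 1; rewrite ?orbF // => /eqP ->.
Qed.

Section Averaging.

Variables (s : 'M[K]_n) (k : nat).
Hypotheses (Cs : corner s) (k_neq0 : k%:R != 0 :> F) (sk : s ^+ k = e).

(** The average of the conjugates of [x] by the powers of [s]; the factors are
    powers of [s] with nonnegative exponents because [s] is invertible in the
    corner only. *)
Definition average x := iota k%:R^-1 *: \sum_(i < k) (s ^+ i *m x *m s ^+ (k - i)).

Lemma average_comm x : corner x -> s *m average x = average x *m s.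
Proof.
move=> [_ ex xe]; rewrite -scalemxAr -scalemxAl; congr (_ *: _).
rewrite mulmx_sumr mulmx_suml.
rewrite (eq_bigr (fun i : 'I_k => s ^+ i.+1 *m x *m s ^+ (k - i))); last first.
  by move=> i _; rewrite !mulmxA exprS.
rewrite [RHS](eq_bigr (fun i : 'I_k => s ^+ i *m x *m s ^+ (k - i).+1)); last first.
  by move=> i _; rewrite -!mulmxA exprSr.
case: k sk => [|m] sm; first by rewrite !big_ord0.
rewrite big_ord_recr [RHS]big_ord_recl /= subSnn subn0 expr1 expr0 mul1mx.
rewrite sm ex exprS sm addrC -mulmxE; congr (_ + _).
  by case: Cs => _ _ ->.
by apply: eq_bigr => i _; rewrite /bump /= add1n subSS -subSn ?(ltnW (ltn_ord i)).
Qed.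

Lemma average_centralizes x y : s *m y = y *m s -> x *m y = y *m x ->
  average x *m y = y *m average x.
Proof.
move=> sy xy; rewrite -scalemxAr -scalemxAl; congr (_ *: _).
have sXy m : s ^+ m *m y = y *m s ^+ m.
  have : GRing.comm y (s ^+ m) by apply: commrX; rewrite /GRing.comm -mulmxE sy.
  by rewrite /GRing.comm -mulmxE => ->.
rewrite mulmx_sumr mulmx_suml; apply: eq_bigr => i _.
by rewrite -mulmxA sXy mulmxA -(mulmxA _ x) xy !mulmxA sXy.
Qed.

Lemma average_lift x : corner x -> corner (average x) /\ theta (average x) = theta x.
Proof.
move=> Cx; have k_gt0 : (0 < k)%N by rewrite lt0n; apply: contraNneq k_neq0 => ->.
have ts : theta s ^+ k = 1 by rewrite -thetaX // sk.
have Csx m : corner (s ^+ m *m x) /\ theta (s ^+ m *m x) = theta s ^+ m * theta x.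
  elim: m => [|m [IHc IHt]]; first by rewrite !expr0 mul1mx mul1r.
  rewrite exprS -mulmxE -mulmxA; split; first exact: cornerM.
  by rewrite thetaM // IHt exprS mulrA.
have Cterm (i : 'I_k) : corner (s ^+ i *m x *m s ^+ (k - i)) /\
    theta (s ^+ i *m x *m s ^+ (k - i)) = theta x.
  have [Ci ti] := Csx i; have ki : (0 < k - i)%N by rewrite subn_gt0.
  split; first by apply: cornerM => //; apply: cornerX.
  rewrite thetaM ?thetaX ?ti //; last exact: cornerX.
  by rewrite mulrAC -exprD subnKC ?ts ?mul1r // ltnW.
have Csum (r : seq 'I_k) : corner (\sum_(i <- r) (s ^+ i *m x *m s ^+ (k - i))) /\
    theta (\sum_(i <- r) (s ^+ i *m x *m s ^+ (k - i))) = (size r)%:R * theta x.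
  elim: r => [|i r [IHr IHt]].
    rewrite !big_nil mul0r -(subrr e); split; first exact: cornerB.
    by rewrite thetaB // subrr.
  have [Ci ti] := Cterm i; rewrite !big_cons; split; first exact: cornerD.
  by rewrite thetaD // IHt ti /= -natr1 mulrDl mul1r addrC.
have [Cr tr] := Csum (index_enum 'I_k).
split; first exact: cornerZ.
rewrite thetaZ // tr mulrA -sum1_size sum1_card card_ord.
by rewrite -(rmorph_nat alpha) -rmorphM mulVf // rmorph1 mul1r.
Qed.

End Averaging.

Definition frame (g : 'M[K]_n) (S : pred 'I_n) : Prop :=
  g \in unitmx /\ e = dg g (fun i => (i \in S)%:R).

Definition unbounded (g : 'M[K]_n) (S : pred 'I_n) : Prop :=
  forall i, i \in S -> forall s : seq K, exists2 f, diag_corner g f & f i \notin s.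

Lemma diag_cornerX g f k : g \in unitmx -> (0 < k)%N -> diag_corner g f ->
  diag_corner g (fun i => f i ^+ k).
Proof. by move=> ug k_gt0 Tf; rewrite /diag_corner -dgX //; apply: cornerX. Qed.

(** If two powers of [x] had the same coordinate [i], then their difference
    would vanish at [i], hence be zero. *)
Lemma frame_lift_infinite g S (x : 'M[K]_n) f : frame g S -> corner x -> x = dg g f ->
  (forall k, (0 < k)%N -> theta x ^+ k != 1) -> theta x != 0 -> unbounded g S.
Proof.
move=> [ug def_e] Cx def_x x_inf x0 i Si s.
have Tf k : diag_corner g (fun i => f i ^+ k.+1).
  by apply: diag_cornerX; rewrite /diag_corner -?def_x.
have inj_f : injective (fun k => f i ^+ k.+1).
  move=> k l /= eq_kl; wlog lt_kl : k l eq_kl / (k < l)%N.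
    move=> IH; have [lt_kl|lt_lk|//] := ltngtP k l; first exact: IH.
    by rewrite (IH l k).
  have fB := diag_corner_domain ug def_e (diag_cornerB (Tf l) (Tf k)) Si.
  have eq_t : theta x ^+ l.+1 = theta x ^+ k.+1.
    rewrite -!thetaX // def_x !dgX //; congr theta; apply: dg_ext => j.
    by apply/eqP; rewrite -subr_eq0 fB // eq_kl subrr.
  have := x_inf (l - k)%N; rewrite subn_gt0 => /(_ lt_kl)/eqP[].
  apply: (mulfI (expf_neq0 k.+1 x0)).
  by rewrite -exprD addSn subnKC ?mulr1 // ltnW.
apply: NNPP => no_f; have : (size (mkseq (fun k => f i ^+ k.+1) (size s).+1) <= size s)%N.
  apply: uniq_leq_size => [|_ /mapP[k _ ->]]; first exact: mkseq_uniq.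
  by apply: contraT => fs; case: no_f; exists (fun i => f i ^+ k.+1).
by rewrite size_mkseq ltnn.
Qed.

Lemma frame_diagonalizable x : corner x -> diagonalizable x ->
  exists g S f, frame g S /\ x = dg g f.
Proof.
move=> [_ ex xe] diag_x; have [_ ee _] := corner_e.
have : codiagonalizable [:: e; x].
  apply/codiagonalizableP; split=> [y z|y].
    by rewrite !inE => /orP[]/eqP-> /orP[]/eqP->; rewrite /comm_mx ?ex ?xe.
  by rewrite !inE => /orP[]/eqP-> //; apply: idempotent_diagonalizable.
move=> /codiagonalizable_dg[g ug diag_g].
have [f1 /(frame_of_diagonal ug)[S def_e]] := diag_g e (mem_head _ _).
have [|f def_x] := diag_g x; first by rewrite !inE eqxx orbT.
by exists g, S, f.
Qed.

Section TorsionFrame.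

Variables (p : nat) (pchF : p \in [pchar F]).
Hypothesis L_torsion : forall a : L, a != 0 -> exists2 k, (0 < k)%N & a ^+ k = 1.

(** Every nonzero member of the list has finite order, prime to the
    characteristic, so one can average over its powers; averaging over one
    member preserves commutation with the others. *)
Lemma centralizer_surjective g f0 (l : seq 'M[K]_n) : g \in unitmx -> e = dg g f0 ->
  (forall s, s \in l -> corner s /\ exists f, s = dg g f) ->
  forall a, exists x, [/\ corner x, theta x = a & forall s, s \in l -> s *m x = x *m s].
Proof.
move=> ug def_e; have pchL : p \in [pchar L] := rmorph_pchar alpha pchF.
have [S def_eS] := frame_of_diagonal ug def_e.
elim: l => [|s l IHl] sl a.
  by have [x Cx tx] := theta_surj a; exists x.
have [|x [Cx tx xl]] := IHl _ a; first by move=> t tl; apply: sl; rewrite inE tl orbT.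
have [Cs [f def_s]] := sl s (mem_head _ _).
have [ts0|ts0] := eqVneq (theta s) 0.
  exists x; split=> // t; rewrite inE => /predU1P[->|]; last exact: xl.
  suff -> : s = 0 by rewrite mul0mx mulmx0.
  rewrite def_s -(dg0 g); apply: dg_ext; apply: (diag_corner_theta0 ug).
    by rewrite /diag_corner -def_s.
  by rewrite -def_s.
have [k [k_gt0 pk sk]] := root_of_unity_coprime pchL ts0 (L_torsion ts0).
have k_neq0 : k%:R != 0 :> F.
  rewrite -(dvdn_pcharf pchF); apply/negP => p_dvd.
  have := coprime_dvdr p_dvd pk; rewrite /coprime gcdnn => /eqP p1.
  by have := pcharf_prime pchF; rewrite p1.
have {}sk : s ^+ k = e.
  rewrite def_s dgX // def_eS; apply: dg_ext.
  apply: (diag_corner_theta_inj ug).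
  - by apply: diag_cornerX => //; rewrite /diag_corner -def_s.
  - by rewrite /diag_corner -def_eS.
  by rewrite -def_eS -dgX // -def_s thetaX // sk theta_e.
have [Cav tav] := average_lift Cs k_neq0 sk Cx.
exists (average s k x); split=> //; first by rewrite tav.
move=> t; rewrite inE => /predU1P[->|tl]; first exact: average_comm.
have [|_ [h def_t]] := sl t; first by rewrite inE tl orbT.
symmetry; apply: average_centralizes; last by rewrite xl.
by rewrite def_s def_t !dgM //; apply: dg_ext => i; rewrite mulrC.
Qed.

(** A list of commuting diagonalizable elements of the corner with the largest
    possible span.  The [p^n]-th power of any element [x] that commutes with
    the list could be added to it, hence lies in its span and is diagonal in
    every basis that diagonalizes the list. *)
Lemma torsion_frame : exists g S, frame g S /\
  forall a, exists f, diag_corner g f /\ theta (dg g f) = a.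
Proof.
have pchK : p \in [pchar K] := rmorph_pchar iota pchF.
have pchL : p \in [pchar L] := rmorph_pchar alpha pchF.
have pe_gt0 : (0 < p ^ n)%N by rewrite expn_gt0 (prime_gt0 (pcharf_prime pchF)).
pose P (l : seq 'M[K]_n) := [/\ forall s, s \in l -> corner s,
  forall s, s \in l -> diagonalizable s & forall s t, s \in l -> t \in l -> comm_mx s t].
have Pe : P [:: e].
  split=> [s|s|s t]; rewrite !inE => /eqP -> //.
    by apply: idempotent_diagonalizable; case: corner_e.
  by move=> /eqP ->.
have [l [Cl diag_l comm_l] [sub_l max_l]] := maximal_mspan Pe.
have /codiagonalizable_dg[g ug gl] : codiagonalizable l.
  by apply/codiagonalizableP; split=> // s t; apply: comm_l.
have [f0 def_e] := gl e (sub_l e (mem_head _ _)).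
have [S def_eS] := frame_of_diagonal ug def_e.
exists g, S; split=> // a.
have [b <-] := torsion_perfect n pchL (L_torsion (a := a)).
have [|x [Cx <- xl]] := centralizer_surjective (l := l) ug def_e _ b.
  by move=> s sl; split; [apply: Cl | apply: gl].
have Ct := cornerX pe_gt0 Cx.
have tl s : s \in l -> comm_mx s (x ^+ (p ^ n)).
  move=> /xl sx; have : GRing.comm s (x ^+ (p ^ n)).
    by apply: commrX; rewrite /GRing.comm -mulmxE sx.
  by [].
have [] := dg_span (x := x ^+ (p ^ n)) gl.
  apply: max_l; split=> [s|s|s t].
  - by rewrite inE => /predU1P[->|/Cl].
  - by rewrite inE => /predU1P[->|/diag_l //]; apply: pchar_power_diagonalizable.
  - rewrite !inE => /predU1P[->|sl] /predU1P[->|tl'] //; last exact: comm_l.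
      by apply: comm_mx_sym; apply: tl.
    exact: tl.
move=> f def_f; exists f; split; first by rewrite /diag_corner -def_f.
by rewrite -def_f thetaX.
Qed.

End TorsionFrame.

(** A polynomial condition on [b e] is a polynomial in [b]; if it holds on the
    infinite field [F], it holds on [K]. *)
Lemma frame_scalars g S : ~ (exists s : seq F, forall x, x \in s) -> frame g S ->
  forall b, diag_corner g (fun i => (i \in S)%:R * b).
Proof.
move=> F_infinite [ug def_e] b; pose c b i := (i \in S)%:R * b : K.
apply: (diag_corner_closed ug def_e) => P P_vanish.
pose Q : {poly K} := \sum_(m <- msupp P) (P@_m * \prod_i (i \in S)%:R ^+ m i) *: 'X^(mdeg m).
have QE x : Q.[x] = P.@[c x].
  rewrite /Q mevalE horner_sum; apply: eq_bigr => m _.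
  rewrite hornerZ hornerXn -mulrA; congr (_ * _).
  rewrite mdegE -prodrXr -big_split; apply: eq_bigr => i _.
  by rewrite /c exprMn.
rewrite -/(c b) -QE (_ : Q = 0) ?horner0 //; apply: poly0_of_roots => s.
have [x xs] := injective_unbounded (fmorph_inj iota) F_infinite s.
exists (iota x) => //; rewrite rootE QE P_vanish //.
have := cornerZ x corner_e; rewrite def_e dgZ /diag_corner.
by congr corner; apply: dg_ext => i; rewrite mulrC.
Qed.

Definition section_of (g : 'M[K]_n) (tau : 'I_n -> L -> K) : Prop :=
  forall a, diag_corner g (tau^~ a) /\ theta (dg g (tau^~ a)) = a.

(** Elements of the corner that are diagonal in the same basis are determined
    by their image in [L], so a section made of such elements is automatically
    multiplicative and linear over [F]. *)
Lemma section_rmorphism g S tau i : frame g S -> section_of g tau -> i \in S ->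
  exists2 sg : {rmorphism L -> K}, sg =1 tau i & forall c, tau i (alpha c) = iota c.
Proof.
move=> [ug def_e] tauP Si.
have inj := diag_corner_theta_inj ug.
have tauT a := (tauP a).1; have tauE a := (tauP a).2.
have tauB : zmod_morphism (tau i).
  move=> a b; apply: (inj (tau^~ (a - b)) (fun i => tau i a - tau i b)) => //.
    exact: diag_cornerB.
  by rewrite -dgB thetaB ?tauE //; apply: tauT.
have T1 := diag_corner1 def_e.
have tau1 : tau i 1 = 1.
  rewrite (inj (tau^~ 1) (fun i => (i \in S)%:R)) ?Si //.
  by rewrite -def_e theta_e tauE.
have tauM : monoid_morphism (tau i).
  split=> // a b; apply: (inj (tau^~ (a * b)) (fun i => tau i a * tau i b)) => //.
    exact: diag_cornerM.
  by rewrite -dgM // [RHS]thetaM ?tauE //; apply: tauT.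
pose sg : {rmorphism L -> K} := HB.pack (tau i)
  (GRing.isZmodMorphism.Build _ _ _ tauB) (GRing.isMonoidMorphism.Build _ _ _ tauM).
exists sg => // c.
have Tc : diag_corner g (fun i => iota c * (i \in S)%:R).
  by rewrite /diag_corner -dgZ -def_e; apply: cornerZ.
rewrite (inj (tau^~ (alpha c)) (fun i => iota c * (i \in S)%:R)) ?Si ?mulr1 //.
by rewrite -dgZ -def_e thetaZ // theta_e mulr1 tauE.
Qed.

Lemma frame_curve p g S : p \in [pchar K] -> frame g S -> unbounded g S ->
  exists w : 'I_n -> nat, forall b, diag_corner g (fun i => (i \in S)%:R * b ^+ (p ^ w i)).
Proof.
move=> pchK [ug def_e] unb.
have [i0 S0] := frame_neq0 def_e.
apply: (@domain_frobenius_curve K n S (diag_corner g) _ _ _ _ _ _ p pchK i0 S0) => //.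
- exact: diag_corner1.
- by move=> f h; apply: diag_cornerB.
- by move=> f h; apply: diag_cornerM.
- move=> f i; exact: (diag_corner_domain ug def_e).
- exact: (diag_corner_closed ug def_e).
Qed.

(** For infinite [F] the scalar multiples of [e] give the section; for finite
    [F] it comes from the curve of [frame_curve] if some basis makes the
    diagonal elements unbounded, and otherwise [L] is finite and [torsion_frame]
    applies.  The exponents of [p] obtained on the curve differ by a power that
    is trivial on [F], hence by a power of [q]. *)
Lemma corner_section q : frobenius_base F q -> exists g S tau,
  [/\ frame g S, section_of g tau &
      forall i j, i \in S -> j \in S -> frobenius_related q (tau i) (tau j)].
Proof.
have choose_curve (g : 'M[K]_n) (S : pred 'I_n) (w : 'I_n -> nat) : frame g S ->
    (forall i, (0 < w i)%N) ->
    (forall i (x y : K), (x + y) ^+ w i = x ^+ w i + y ^+ w i) ->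
    (forall b, diag_corner g (fun i => (i \in S)%:R * b ^+ w i)) ->
    exists b : L -> K, section_of g (fun i a => (i \in S)%:R * b a ^+ w i).
  move=> [ug def_e] w_gt0 wD curve.
  have b_ex := curve_surjective ug def_e w_gt0 wD curve.
  have [b bP] := dependent_choice b_ex.
  by exists b => a; split; [apply: curve | apply: bP].
case=> [[s [us mem_s def_q]]|[F_infinite ->]]; last first.
  have [_ ee _] := corner_e.
  have [g [S [_ [fr _]]]] := frame_diagonalizable corner_e (idempotent_diagonalizable ee).
  have [|||b tauP] := choose_curve g S (fun=> 1%N) fr => //.
    by move=> b; apply: frame_scalars.
  exists g, S, (fun i a => (i \in S)%:R * b a ^+ 1); split=> // i j Si Sj.
  by exists 0%N; left=> y; rewrite Si Sj.
have [_ [p [f [pchF f_gt0 def_pf]]]] := finite_field_structure us mem_s def_q.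
have pchK : p \in [pchar K] := rmorph_pchar iota pchF.
have p_pr := pcharf_prime pchF.
suff [[g [S [fr unb]]]|[g [S [tau [fr tauP [sL memL]]]]]] :
    (exists g S, frame g S /\ unbounded g S) \/
    (exists g S tau, [/\ frame g S, section_of g tau &
                         exists s : seq L, forall x, x \in s]).
- have [w curve] := frame_curve pchK fr unb.
  have [|||b tauP] := choose_curve g S (fun i => (p ^ w i)%N) fr => //.
  + by move=> i; rewrite expn_gt0 prime_gt0.
  + by move=> i x y; rewrite (exp_pcharD pchK).
  pose tau i a := (i \in S)%:R * b a ^+ (p ^ w i).
  exists g, S, tau; split=> // i j Si Sj.
  wlog le_w : i j Si Sj / (w i <= w j)%N.
    move=> IH; have [/IH|lt_w] := leqP (w i) (w j); first exact.
    have [d [rel|rel]] := IH j i Sj Si (ltnW lt_w); exists d; [by right | by left].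
  have tau_ij y : tau j y = tau i y ^+ (p ^ (w j - w i)).
    by rewrite /tau Si Sj !mul1r -exprM -expnD subnKC.
  have [_ _ tau_i] := section_rmorphism fr tauP Si.
  have [_ _ tau_j] := section_rmorphism fr tauP Sj.
  have [c|d def_d] := fixed_power_card us mem_s def_q (e := w j - w i) pchF.
    apply: (fmorph_inj iota); rewrite rmorphXn -[RHS]tau_j.
    by rewrite -/(tau j (alpha c)) tau_ij -tau_i.
  by exists d; right=> y; rewrite tau_ij def_d.
- exists g, S, tau; split=> // i j Si Sj.
  have [sg1 sgE1 alpha1] := section_rmorphism fr tauP Si.
  have [sg2 sgE2 alpha2] := section_rmorphism fr tauP Sj.
  have [x|c|d rel] := finite_embeddings_related (s1 := sg1) (s2 := sg2) (alpha := alpha)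
      us mem_s def_q (undup_uniq sL).
  + by rewrite mem_undup.
  + by rewrite sgE1 sgE2 alpha1 alpha2.
  by exists d; case: rel => rel; [left | right] => y; rewrite -sgE1 -sgE2 rel.
have [L_torsion|L_free] :=
    classic (forall a : L, a != 0 -> exists2 k, (0 < k)%N & a ^+ k = 1).
  have [g [S [fr lift]]] := torsion_frame pchF L_torsion.
  have [h hP] := dependent_choice lift; pose tau i a := h a i.
  have tauP : section_of g tau by move=> a; apply: hP.
  have [L_finite|L_infinite] := classic (exists s : seq L, forall x, x \in s).
    by right; exists g, S, tau.
  left; exists g, S; split=> // i Si s1.
  have [sg sgE _] := section_rmorphism fr tauP Si.
  have [a] := injective_unbounded (fmorph_inj sg) L_infinite s1.
  by rewrite sgE => tau_a; exists (tau^~ a) => //; apply: (tauP a).1.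
left; have [y y0 y_free] : exists2 y : L, y != 0 & forall k, (0 < k)%N -> y ^+ k != 1.
  apply: NNPP => no_y; apply: L_free => a a0; apply: NNPP => no_k; apply: no_y.
  by exists a => // k k_gt0; apply/eqP => ak; apply: no_k; exists k.
have [x Cx tx] := theta_surj y.
have pe_gt0 : (0 < p ^ n)%N by rewrite expn_gt0 prime_gt0.
have Cxp := cornerX pe_gt0 Cx.
have [g [S [f1 [fr def_x]]]] := frame_diagonalizable Cxp (pchar_power_diagonalizable x pchK).
exists g, S; split=> //; apply: (frame_lift_infinite fr Cxp def_x) => [k k_gt0|].
  by rewrite thetaX // tx -exprM y_free // muln_gt0 pe_gt0.
by rewrite thetaX // tx expf_neq0.
Qed.

End Corner.

(** * Lifting matrix units modulo a nil ideal *)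

(** [1 - (1 - X^m)^m] is divisible by [X^m], and its difference from [1] by
    [(1 - X)^m]. *)
Lemma idempotent_of_nilpotent (K : fieldType) n (x : 'M[K]_n) m :
  (x *m x - x) ^+ m = 0 ->
  let y := 1 - (1 - x ^+ m) ^+ m in y *m y = y.
Proof.
case: n x => [|n] x xm y; first by rewrite [RHS]thinmx0 [LHS]thinmx0.
pose P : {poly K} := 1 - (1 - 'X^m) ^+ m.
have [Q1 def_P] : exists Q, P = Q * 'X^m.
  exists (\sum_(i < m) 1 ^+ (m.-1 - i) * (1 - 'X^m) ^+ i).
  by rewrite mulrC -{1}['X^m](subKr 1) -subrXX expr1n.
have [Q2 def_P1] : exists Q, 1 - P = Q * (1 - 'X) ^+ m.
  exists ((\sum_(i < m) 1 ^+ (m.-1 - i) * 'X ^+ i) ^+ m).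
  by rewrite subKr -exprMn mulrC -subrXX expr1n.
have def_y : y = horner_mx x P.
  by rewrite /y /P !(rmorphB, rmorphXn, rmorph1) /= horner_mx_X.
clearbody P; clearbody y.
apply/eqP; rewrite -subr_eq0 -oppr_eq0 opprB -{1}[y]mulmx1 -mulmxBr mulmxE.
have -> : 1%:M - y = horner_mx x (1 - P) by rewrite rmorphB (rmorph1 (horner_mx x)) def_y.
rewrite def_y -rmorphM def_P1 def_P mulrACA -exprMn rmorphM rmorphXn /=.
have -> : horner_mx x ('X * (1 - 'X)) = - (x *m x - x).
  by rewrite mulrBr mulr1 opprB -expr2 rmorphB rmorphXn /= horner_mx_X.
by rewrite exprNn xm !mulr0.
Qed.

Lemma nilpotent_idempotent (K : fieldType) n (x : 'M[K]_n) m :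
  x *m x = x -> x ^+ m = 0 -> x = 0.
Proof.
move=> xx xm; suff xk k : x ^+ k.+1 = x by rewrite -(xk m) exprS xm mulr0.
by elim: k => [|k IHk] //; rewrite exprS IHk -mulmxE xx.
Qed.

Section Lifting.

Variables (F K : fieldType) (iota : {rmorphism F -> K}) (n : nat).
Variables (A J : 'M[K]_n -> Prop).
Hypothesis hA : subalgebra iota A.
Hypothesis J_nil : nil_ideal iota A J.
Variables (k : nat) (nu : 'I_k -> nat) (hnu : forall u, (0 < nu u)%N).
Variables (L : 'I_k -> fieldType) (alpha : forall u, {rmorphism F -> L u}).
Variable pi : forall u, 'M[K]_n -> 'M[L u]_(nu u).
Hypothesis hpi : quotient_isomorphism iota A J alpha pi.

Lemma subalg0 : A 0. Proof. by case: hA. Qed.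

Lemma subalgD x y : A x -> A y -> A (x + y). Proof. by case: hA => _ + _ _; apply. Qed.

Lemma subalgM x y : A x -> A y -> A (x *m y). Proof. by case: hA => _ _ + _; apply. Qed.

Lemma subalgZ c x : A x -> A (iota c *: x). Proof. by case: hA => _ _ _; apply. Qed.

Lemma subalgN x : A x -> A (- x).
Proof. by move=> Ax; rewrite -scaleN1r -(rmorphN1 iota); apply: subalgZ. Qed.

Lemma subalgB x y : A x -> A y -> A (x - y).
Proof. by move=> Ax Ay; apply: subalgD => //; apply: subalgN. Qed.

Lemma subalgX x m : (0 < m)%N -> A x -> A (x ^+ m).
Proof.
case: m => // m _ Ax; elim: m => [|m IHm] //.
by rewrite exprS -mulmxE; apply: subalgM.
Qed.

Lemma subalg_sum (I : Type) (r : seq I) (f : I -> 'M[K]_n) :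
  (forall i, A (f i)) -> A (\sum_(i <- r) f i).
Proof.
by move=> Af; elim/big_ind: _ => //; [apply: subalg0 | move=> x y; apply: subalgD].
Qed.

Lemma piD u x y : A x -> A y -> pi u (x + y) = pi u x + pi u y.
Proof. by case: hpi => + _ _ _ _; apply. Qed.

Lemma piM u x y : A x -> A y -> pi u (x *m y) = pi u x *m pi u y.
Proof. by case: hpi => _ + _ _ _; apply. Qed.

Lemma piZ u c x : A x -> pi u (iota c *: x) = alpha u c *: pi u x.
Proof. by case: hpi => _ _ + _ _; apply. Qed.

Lemma piN u x : A x -> pi u (- x) = - pi u x.
Proof. by move=> Ax; rewrite -scaleN1r -(rmorphN1 iota) piZ // rmorphN1 scaleN1r. Qed.

Lemma piB u x y : A x -> A y -> pi u (x - y) = pi u x - pi u y.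
Proof. by move=> Ax Ay; rewrite piD ?piN //; apply: subalgN. Qed.

Lemma pi0 u : pi u 0 = 0.
Proof. by rewrite -(subrr 0) piB ?subrr //; apply: subalg0. Qed.

Lemma piX u x m : (0 < m)%N -> A x -> pi u (x ^+ m) = pi u x ^+ m.
Proof.
case: m => // m _ Ax; elim: m => [|m IHm] //.
by rewrite exprS -mulmxE piM ?IHm; [rewrite [RHS]exprS | | apply: subalgX].
Qed.

Lemma pi_sum u (I : Type) (r : seq I) (f : I -> 'M[K]_n) :
  (forall i, A (f i)) -> pi u (\sum_(i <- r) f i) = \sum_(i <- r) pi u (f i).
Proof.
move=> Af; elim: r => [|i r IHr]; first by rewrite !big_nil pi0.
by rewrite !big_cons piD ?IHr //; apply: subalg_sum.
Qed.

Lemma pi_nilpotent x : A x -> (forall u, pi u x = 0) -> exists m : nat, x ^+ m = 0.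
Proof.
move=> Ax x0; case: J_nil => _; apply.
by case: hpi => _ _ _ J_ker _; apply/J_ker.
Qed.

Lemma pi_idempotent0 x : A x -> x *m x = x -> (forall u, pi u x = 0) -> x = 0.
Proof. by move=> Ax xx /(pi_nilpotent Ax)[m]; apply: nilpotent_idempotent. Qed.

Lemma lift_idempotent x : A x -> (forall u, pi u x *m pi u x = pi u x) ->
  exists y, [/\ A y, y *m y = y, forall u, pi u y = pi u x &
    forall z, (z *m x = 0 -> z *m y = 0) /\ (x *m z = 0 -> y *m z = 0)].
Proof.
move=> Ax xx; have Axx := subalgB (subalgM Ax Ax) Ax.
have [|m0 xm0] := pi_nilpotent Axx.
  by move=> u; rewrite piB ?piM ?xx ?subrr //; apply: subalgM.
pose m := m0.+1; have xm : (x *m x - x) ^+ m = 0 by rewrite exprS xm0 mulr0.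
have xX u j : pi u x ^+ j.+1 = pi u x.
  by elim: j => [|j IHj] //; rewrite exprS IHj -mulmxE xx.
have Axm : A (x ^+ m) by apply: subalgX.
have Az j : A (1 - (1 - x ^+ m) ^+ j) /\
    (0 < j -> forall u, pi u (1 - (1 - x ^+ m) ^+ j) = pi u x)%N.
  elim: j => [|j [Aj pj]]; first by rewrite expr0 subrr; split=> //; apply: subalg0.
  have -> : 1 - (1 - x ^+ m) ^+ j.+1 =
      (1 - (1 - x ^+ m) ^+ j) + x ^+ m - (1 - (1 - x ^+ m) ^+ j) *m x ^+ m.
    rewrite mulmxE exprSr mulrBr mulr1 [(1 - (1 - x ^+ m) ^+ j) * _]mulrBl mul1r !opprB.
    by rewrite -[RHS]addrA (addrC (x ^+ m)) subrK addrA addrAC.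
  have AjM := subalgM Aj Axm.
  split=> [|_ u]; first by apply: subalgB => //; apply: subalgD.
  rewrite (piB _ (subalgD Aj Axm) AjM) (piD _ Aj Axm) (piM _ Aj Axm) piX // xX; case: j {Aj AjM} pj => [_|j pj].
    by rewrite expr0 subrr pi0 mul0mx subr0 add0r.
  by rewrite pj // xx addrK.
exists (1 - (1 - x ^+ m) ^+ m); have [Ay py] := Az m; split=> //.
- exact: idempotent_of_nilpotent.
- exact: py.
move=> z; split=> zx.
  have zw : z * (1 - x ^+ m) = z.
    by rewrite mulrBr mulr1 exprS mulrA -[z * x]/(z *m x) zx mul0r subr0.
  rewrite mulmxE mulrBr mulr1; apply/eqP; rewrite subr_eq0 eq_sym; apply/eqP.
  move: (1 - x ^+ m) zw => w zw.
  by elim: (m) => [|j IHj]; rewrite ?expr0 ?mulr1 // exprS mulrA zw IHj.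
have wz : (1 - x ^+ m) * z = z.
  by rewrite mulrBl mul1r exprSr -mulrA -[x * z]/(x *m z) zx mulr0 subr0.
rewrite mulmxE mulrBl mul1r; apply/eqP; rewrite subr_eq0 eq_sym; apply/eqP.
move: (1 - x ^+ m) wz => w wz.
by elim: (m) => [|j IHj]; rewrite ?expr0 ?mul1r // exprSr -mulrA wz IHj.
Qed.

(** The idempotents are lifted one after the other; each one is first multiplied
    on both sides by the complement [1 - f] of the sum [f] of the preceding
    lifts, which does not change its image, and [lift_idempotent] keeps the
    orthogonality. *)
Lemma lift_orthogonal_idempotents (I : finType) (x : I -> 'M[K]_n) :
  (forall i, A (x i)) ->
  (forall u i j, pi u (x i) *m pi u (x j) = if i == j then pi u (x i) else 0) ->
  exists y : I -> 'M[K]_n, [/\ forall i, A (y i), forall u i, pi u (y i) = pi u (x i) &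
    forall i j, y i *m y j = if i == j then y i else 0].
Proof.
move=> Ax xx.
suff main (s : seq I) : uniq s -> exists y : I -> 'M[K]_n,
    [/\ forall i, A (y i), forall u i, pi u (y i) = pi u (x i) &
    forall i j, i \in s -> j \in s -> y i *m y j = if i == j then y i else 0].
  have [y [Ay py yy]] := main (enum I) (enum_uniq I).
  by exists y; split=> // i j; apply: yy; rewrite mem_enum.
elim: s => [_|i0 s IHs /= /andP[i0s us]]; first by exists x.
have [y [Ay py yy]] := IHs us; pose f := \sum_(j <- s) y j.
have Af : A f by apply: subalg_sum.
have yf j : j \in s -> y j *m f = y j.
  move=> js; rewrite mulmx_sumr (bigD1_seq j) //= yy // eqxx.
  rewrite big_seq_cond big1 ?addr0 // => j' /andP[j's /negPf jj'].
  by rewrite yy // eq_sym jj'.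
have fy j : j \in s -> f *m y j = y j.
  move=> js; rewrite mulmx_suml (bigD1_seq j) //= yy // eqxx.
  rewrite big_seq_cond big1 ?addr0 // => j' /andP[j's /negPf jj'].
  by rewrite yy // jj'.
have ff : f *m f = f.
  rewrite {1}/f mulmx_suml [RHS]big_seq big_seq; apply: eq_bigr => j; exact: yf.
have pf u : pi u f *m pi u (x i0) = 0 /\ pi u (x i0) *m pi u f = 0.
  rewrite pi_sum // mulmx_suml mulmx_sumr !big_seq.
  split; rewrite big1 // => j js; rewrite py xx ifN //.
    by apply: contraNneq i0s => <-.
  by apply: contraNneq i0s => ->.
pose x' := (x i0 - f *m x i0) - (x i0 - f *m x i0) *m f.
have Afx := subalgM Af (Ax i0); have A1 := subalgB (Ax i0) Afx; have A1f := subalgM A1 Af.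
have Ax' : A x' by apply: subalgB.
have px' u : pi u x' = pi u (x i0).
  have [fx xf] := pf u.
  by rewrite /x' piB ?piM ?piB ?piM // fx subr0 xf subr0.
have fx' : f *m x' = 0.
  rewrite /x' mulmxBr mulmxA [f *m (_ - _)]mulmxBr mulmxA ff subrr mul0mx subrr //.
have x'f : x' *m f = 0 by rewrite /x' mulmxBl -[_ *m f *m f]mulmxA ff subrr.
have [|z [Az zz pz z_ann]] := lift_idempotent Ax'.
  by move=> u; rewrite px' xx eqxx.
have fz : f *m z = 0 by apply: (z_ann f).1.
have zf : z *m f = 0 by apply: (z_ann f).2.
exists (fun i => if i == i0 then z else y i); split=> [i|u i|i j].
- by case: ifP.
- by case: eqP => [->|_]; rewrite ?pz.
rewrite !inE; have [->|ni] := eqVneq i i0; have [->|nj] := eqVneq j i0 => //=.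
- by move=> _ js; rewrite -(fy j) // mulmxA zf mul0mx.
- by move=> is_ _; rewrite (negPf ni) -(yf i) // -mulmxA fz mulmx0.
exact: yy.
Qed.

Definition lifts u (M : 'M[L u]_(nu u)) x : Prop :=
  [/\ A x, pi u x = M & forall v, v != u -> pi v x = 0].

Lemma lift_component u (M : 'M[L u]_(nu u)) : exists x, lifts M x.
Proof.
pose y v : 'M[L v]_(nu v) := match eqVneq u v with
  | EqNotNeq E => eq_rect u (fun w => 'M[L w]_(nu w)) M v E | NeqNotEq _ => 0 end.
case: hpi => _ _ _ _ /(_ y)[x Ax px]; exists x; split=> //.
  rewrite px /y; case: eqVneq => [E|]; last by rewrite eqxx.
  by rewrite (eq_irrelevance E (erefl u)).
move=> v vu; rewrite px /y; case: eqVneq => // E.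
by rewrite E eqxx in vu.
Qed.

Lemma liftsM u (M N : 'M[L u]_(nu u)) x y :
  lifts M x -> lifts N y -> lifts (M *m N) (x *m y).
Proof.
move=> [Ax px x0] [Ay py y0]; split=> [||v vu]; first exact: subalgM.
  by rewrite piM // px py.
by rewrite piM // x0 // mul0mx.
Qed.

Lemma lifts_mul_neq u v (M : 'M[L u]_(nu u)) (N : 'M[L v]_(nu v)) x y :
  u != v -> lifts M x -> lifts N y -> forall w, pi w (x *m y) = 0.
Proof.
move=> uv [Ax px x0] [Ay py y0] w; rewrite piM //.
have [->|wu] := eqVneq w u; first by rewrite y0 // mulmx0.
by rewrite x0 // mul0mx.
Qed.

Lemma lifts_nilpotent u x : lifts (0 : 'M[L u]_(nu u)) x -> exists m : nat, x ^+ m = 0.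
Proof.
move=> [Ax px x0]; apply: pi_nilpotent => // v.
by have [->|/x0] := eqVneq v u.
Qed.

Definition unit_index u : 'I_(nu u) := Ordinal (hnu u).

Lemma lift_diagonal_units : exists d : forall u, 'I_(nu u) -> 'M[K]_n,
  [/\ forall u i, lifts (delta_mx i i) (d u i),
      forall u i j, d u i *m d u j = if i == j then d u i else 0
    & forall u v i j, u != v -> d u i *m d v j = 0].
Proof.
pose I := {u : 'I_k & 'I_(nu u)}.
have x_ex (p : I) : exists x, lifts (delta_mx (tagged p) (tagged p)) x.
  exact: lift_component.
have [x xP] := dependent_choice x_ex.
pose mk u (i : 'I_(nu u)) : I := Tagged (fun u => 'I_(nu u)) i.
have mkE u (i j : 'I_(nu u)) : (mk u i == mk u j) = (i == j) by rewrite eq_Tagged.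
have mk_neq u v (i : 'I_(nu u)) (j : 'I_(nu v)) : u != v -> (mk u i == mk v j) = false.
  by move=> uv; apply: contra_neqF uv => /eqP/(congr1 tag).
have [p|u [v i] [w j]|y [Ay py yy]] := @lift_orthogonal_idempotents I x.
- by case: (xP p).
- have [Ax px x0] := xP (mk v i); have [Ay py y0] := xP (mk w j).
  have [vw|vw] := eqVneq v w; last first.
    rewrite (mk_neq v w) // -piM //.
    exact: (lifts_mul_neq vw (xP (mk v i)) (xP (mk w j))).
  case: w / vw j Ay py y0 => j Ay py y0; rewrite (mkE v).
  have [uv|uv] := eqVneq u v; last first.
    by rewrite x0 // mul0mx if_same.
  case: v / uv i j px x0 py y0 Ax Ay => i j px x0 py y0 Ax Ay.
  by rewrite px py /= mul_delta_mx_cond; case: eqP => [->|].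
exists (fun u i => y (mk u i)); split=> [u i|u i j|u v i j uv].
- have [_ px x0] := xP (mk u i).
  by split=> [||v vu]; [apply: Ay | rewrite py | rewrite py x0].
- by rewrite yy mkE.
by rewrite yy mk_neq.
Qed.

(** The lifts [a0] and [b0] of the units at [(i, j)] and [(j, i)] have product
    [d + x] with [x] nilpotent; the geometric series for the inverse of [1 + x]
    corrects [a0].  Then [b0 a] is an idempotent below [d'] that is congruent
    to it, hence equal to it. *)
Lemma lift_unit_pair u (i j : 'I_(nu u)) d d' :
  lifts (delta_mx i i) d -> lifts (delta_mx j j) d' -> d *m d = d -> d' *m d' = d' ->
  exists a b, [/\ lifts (delta_mx i j) a, lifts (delta_mx j i) b,
    d *m a = a /\ a *m d' = a, d' *m b = b /\ b *m d = b & a *m b = d /\ b *m a = d'].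
Proof.
move=> ld ld' dd d'd'.
have [a1 la1] := lift_component (delta_mx i j : 'M[L u]_(nu u)).
have [b1 lb1] := lift_component (delta_mx j i : 'M[L u]_(nu u)).
pose a0 := d *m a1 *m d'; pose b := d' *m b1 *m d.
have la0 : lifts (delta_mx i j) a0.
  by have := liftsM (liftsM ld la1) ld'; rewrite !mul_delta_mx.
have lb : lifts (delta_mx j i) b.
  by have := liftsM (liftsM ld' lb1) ld; rewrite !mul_delta_mx.
have da0 : d *m a0 = a0 by rewrite /a0 !mulmxA dd.
have a0d' : a0 *m d' = a0 by rewrite /a0 -mulmxA d'd'.
have d'b : d' *m b = b by rewrite /b !mulmxA d'd'.
have bd : b *m d = b by rewrite /b -mulmxA dd.
pose x := a0 *m b - d; have [Aa0 _ _] := la0; have [Ab _ _] := lb; have [Ad _ _] := ld.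
have Ax : A x by apply: subalgB => //; apply: subalgM.
have px v : pi v x = 0.
  have [Aab pab abv] := liftsM la0 lb; have [_ pd dv] := ld.
  rewrite piB //; have [->|vu] := eqVneq v u; last by rewrite abv // dv // subrr.
  by rewrite pab pd mul_delta_mx subrr.
have [m xm] := pi_nilpotent Ax px.
have dx : d *m x = x by rewrite mulmxBr mulmxA da0 dd.
have xd : x *m d = x by rewrite mulmxBl -mulmxA bd dd.
have def_x : a0 *m b = x + d by rewrite subrK.
clearbody x a0 b.
pose T r := \sum_(s < r) (- x) ^+ s.
have TS r : T r.+1 = 1 - x *m T r.
  rewrite /T big_ord_recl expr0 mulmx_sumr -sumrN; congr (_ + _).
  by apply: eq_bigr => s _; rewrite exprS mulNr.
have TSr r : T r.+1 = 1 - T r *m x.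
  rewrite /T big_ord_recl expr0 mulmx_suml -sumrN; congr (_ + _).
  by apply: eq_bigr => s _; rewrite exprSr mulrN.
have T1x : T m.+1 *m (1 + x) = 1.
  have eqT : T m.+1 = T m.+2.
    have Nxm : (- x) ^+ m.+1 = 0 by rewrite exprNn [x ^+ _]exprS xm !mulr0.
    by rewrite [RHS]/T big_ord_recr /= Nxm addr0.
  by rewrite mulmxDr mulmx1 {1}eqT TSr subrK.
have TP r : [/\ A (T r.+1 *m a0), forall v, pi v (T r.+1 *m a0) = pi v a0 &
                d *m T r.+1 = T r.+1 *m d].
  elim: r => [|r [AT pT dT]].
    have -> : T 1%N = 1 by rewrite /T big_ord1 expr0.
    by split=> //; rewrite ?mul1mx ?mulmx1.
  have AxT := subalgM Ax AT.
  rewrite TS mulmxBl mul1mx -mulmxA; split=> [|v|]; first exact: subalgB.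
    by rewrite piB // (piM v Ax AT) px mul0mx subr0.
  rewrite mulmxE mulrBr mulrBl mulr1 mul1r -!mulmxE; congr (_ - _).
  by rewrite mulmxA dx -mulmxA -dT mulmxA xd.
pose a := T m.+1 *m a0; have [Aa pa dT] := TP m.
have da : d *m a = a by rewrite /a mulmxA dT -mulmxA da0.
have ad' : a *m d' = a by rewrite /a -mulmxA a0d'.
have ab : a *m b = d.
  rewrite /a -mulmxA def_x -{1}xd -{2}[d]mul1mx -mulmxDl.
  by rewrite mulmxA (addrC x) T1x mul1mx.
have la : lifts (delta_mx i j) a.
  have [_ pa0 a00] := la0; split=> // [|v vu]; first by rewrite pa.
  by rewrite pa a00.
exists a, b; split=> //; split=> //; apply/esym/eqP; rewrite -subr_eq0; apply/eqP.
have [Aba pba baU] := liftsM lb la; have [Ad' pd' d'U] := ld'.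
apply: pi_idempotent0; first exact: subalgB.
  rewrite mulmxBl !mulmxBr d'd' mulmxA d'b -(mulmxA b a d') ad'.
  have -> : b *m a *m (b *m a) = b *m a by rewrite mulmxA -(mulmxA b a b) ab bd.
  by rewrite subrr subr0.
move=> v; rewrite piB //; have [->|vu] := eqVneq v u; last by rewrite baU // d'U // subrr.
by rewrite pba pd' mul_delta_mx subrr.
Qed.

Lemma lift_matrix_units : exists (d : forall u, 'M[K]_n) (a b : forall u, 'I_(nu u) -> 'M[K]_n),
  [/\ forall u, lifts (delta_mx (unit_index u) (unit_index u)) (d u) /\ d u *m d u = d u,
      forall u j, [/\ lifts (delta_mx (unit_index u) j) (a u j), d u *m a u j = a u j,
                       lifts (delta_mx j (unit_index u)) (b u j) & b u j *m d u = b u j],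
      forall u i j, a u i *m b u j = if i == j then d u else 0
    & forall u v i j, u != v -> a u i *m b v j = 0].
Proof.
have [d [ld dd duv]] := lift_diagonal_units.
have ddi u i : d u i *m d u i = d u i by rewrite dd eqxx.
pose Q u j a b := [/\ lifts (delta_mx (unit_index u) j) a,
  lifts (delta_mx j (unit_index u)) b, d u (unit_index u) *m a = a /\ a *m d u j = a,
  d u j *m b = b /\ b *m d u (unit_index u) = b
  & a *m b = d u (unit_index u) /\ b *m a = d u j].
have pair_of u j : exists a b, Q u j a b := lift_unit_pair (ld _ _) (ld _ _) (ddi _ _) (ddi _ _).
have [a aP] := dependent_choice (fun u => dependent_choice (pair_of u)).
have [b bP] := dependent_choice (fun u => dependent_choice (aP u)).
exists (fun u => d u (unit_index u)), a, b; split=> [u|u j|u i j|u v i j uv].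
- by [].
- by have [la lb [da _] [_ bd] _] := bP u j.
- have [_ _ [_ ad] _ [ab _]] := bP u i; have [_ _ _ [db _] _] := bP u j.
  have [ij|ij] := eqVneq i j; first by rewrite -ab ij.
  by rewrite -ad -db mulmxA -(mulmxA _ (d u i)) dd (negPf ij) mulmx0 mul0mx.
have [_ _ [_ ad] _ _] := bP u i; have [_ _ _ [db _] _] := bP v j.
by rewrite -ad -db mulmxA -(mulmxA _ (d u i)) duv // mulmx0 mul0mx.
Qed.

End Lifting.

(** * Coordinates in a basis made of blocks *)

Section BlockBasis.

Variables (K : fieldType) (n k : nat) (nu : 'I_k -> nat) (D : layout n nu).
Variable b : forall l : 'I_(nblocks D), 'M[K]_(bsize l, n).

Definition block_basis : 'M[K]_n := castmx (bsize_sum D, erefl n) (\mxcol_l b l).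

Lemma block_basis_unit : row_full (\sum_l <<b l>>)%MS -> block_basis \in unitmx.
Proof.
rewrite -row_full_unit /block_basis; case: (D) b => N bs bt bE bs_sum /= b' full_b.
case: n / bs_sum b' full_b => b' full_b; rewrite castmx_id.
by rewrite /row_full eqmx_col.
Qed.

Lemma block_basis_mul (c : 'M[K]_n) (M : forall l l', 'M[K]_(bsize l, bsize l')) x :
  block_basis \in unitmx ->
  c *m block_basis = block_basis *m x ->
  (forall l, b l *m x = \sum_l' M l l' *m b l') ->
  forall l l', block c l l' = M l l'.
Proof.
rewrite -row_free_unit /block_basis /block.
case: (D) b M => N bs bt bE bs_sum /= b' M free_b cb_bx bM l l'.
case: n / bs_sum b' c x free_b cb_bx bM => b' c x; rewrite !castmx_id => free_b cb_bx bM.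
suff -> : c = \mxblock_(l, l') M l l' by rewrite mxblockK.
apply: (row_free_inj free_b); rewrite cb_bx mxcol_mul mul_mxblock_mxrow.
by apply: eq_mxcol => i; apply: bM.
Qed.

End BlockBasis.

Definition conj_units (K : fieldType) n (g : 'M[K]_n) (i j : 'I_n) : 'M[K]_n :=
  invmx g *m delta_mx i j *m g.

Lemma conj_matrix_units (K : fieldType) n (g : 'M[K]_n) :
  g \in unitmx -> matrix_units (conj_units g).
Proof.
move=> ug; split=> [i j k l|].
  rewrite /conj_units !mulmxA mulmxK // -(mulmxA _ (delta_mx i j)) mul_delta_mx_cond.
  by case: eqP => _; rewrite ?scale1r // scale0r mulr0n mulmx0 mul0mx.
rewrite -mulmx_suml -mulmx_sumr (_ : \sum_i delta_mx i i = 1%:M) ?mulmx1 ?mulVmx //.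
by rewrite -diag_const_mx diag_mx_sum_delta; apply: eq_bigr => i _; rewrite mxE scale1r.
Qed.

Lemma of_conj_coords (K : fieldType) n (g c : 'M[K]_n) :
  of_coords (conj_units g) c = invmx g *m c *m g.
Proof.
rewrite {2}[c]matrix_sum_delta /of_coords mulmx_sumr mulmx_suml.
apply: eq_bigr => i _; rewrite mulmx_sumr mulmx_suml; apply: eq_bigr => j _.
by rewrite -scalemxAr -scalemxAl.
Qed.

Lemma delta_sandwich (R : fieldType) n (i : 'I_n) (M : 'M[R]_n) :
  delta_mx i i *m M *m delta_mx i i = M i i *: delta_mx i i.
Proof.
apply/matrixP => r s; rewrite !mxE (bigD1 i) //= big1 => [|j ji]; last first.
  by rewrite !mxE (negPf ji) mulr0.
rewrite !mxE eqxx addr0 (bigD1 i) //= big1 => [|j ji]; last first.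
  by rewrite !mxE (negPf ji) andbF mul0r.
by rewrite !mxE eqxx addr0 andbT; case: (r == i); rewrite ?mul1r // !mul0r mulr0.
Qed.

(** * The semisimple part *)

Section Wedderburn.

Variables (F : fieldType) (K : closedFieldType) (iota : {rmorphism F -> K}).
Variables (q : nat) (hq : frobenius_base F q).
Variables (n : nat) (A J : 'M[K]_n -> Prop).
Hypotheses (hA : subalgebra iota A) (hclosed : zariski_closed A).
Hypothesis J_nil : nil_ideal iota A J.
Variables (k : nat) (nu : 'I_k -> nat) (hnu : forall u, (0 < nu u)%N).
Variable L : 'I_k -> fieldType.
Variable alpha : forall u, {rmorphism F -> L u}.
Variable pi : forall u, 'M[K]_n -> 'M[L u]_(nu u).
Hypothesis hpi : quotient_isomorphism iota A J alpha pi.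

Notation i0 u := (unit_index hnu u).

Definition diagonal_section u (d g : 'M[K]_n) (S : pred 'I_n) (tau : 'I_n -> L u -> K) :=
  [/\ g \in unitmx, d = dg g (fun i => (i \in S)%:R),
      forall a, A (dg g (tau^~ a)) /\ pi u (dg g (tau^~ a)) = a *: delta_mx (i0 u) (i0 u),
      forall i, if i \in S then
        exists2 sg : {rmorphism L u -> K}, sg =1 tau i & forall c, tau i (alpha u c) = iota c
        else forall a, tau i a = 0
    & forall i j, i \in S -> j \in S -> frobenius_related q (tau i) (tau j)].

Lemma component_section u d : lifts A pi (delta_mx (i0 u) (i0 u)) d -> d *m d = d ->
  exists g S tau, @diagonal_section u d g S tau.
Proof.
move=> ld dd; have [Ad pd d0] := ld; pose theta x := pi u x (i0 u) (i0 u).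
have Cd : corner A d d by [].
have corner_pi x : corner A d x -> pi u x = theta x *: delta_mx (i0 u) (i0 u).
  move=> [Ax dx xd]; rewrite -delta_sandwich -pd.
  by rewrite -!(piM hpi) ?dx ?xd //; apply: (subalgM hA).
have thetaD x y : corner A d x -> corner A d y -> theta (x + y) = theta x + theta y.
  by move=> [Ax _ _] [Ay _ _]; rewrite /theta (piD hpi) // mxE.
have thetaM x y : corner A d x -> corner A d y -> theta (x *m y) = theta x * theta y.
  move=> Cx Cy; rewrite /theta (piM hpi); try by [case: Cx | case: Cy].
  rewrite (corner_pi x Cx) (corner_pi y Cy) -scalemxAl -scalemxAr mul_delta_mx.
  by rewrite !mxE !eqxx !mulr1.
have thetaZ c x : corner A d x -> theta (iota c *: x) = alpha u c * theta x.
  by move=> [Ax _ _]; rewrite /theta (piZ hpi) // mxE.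
have theta_d : theta d = 1 by rewrite /theta pd mxE !eqxx.
have theta_surj a : exists2 x, corner A d x & theta x = a.
  have [x [Ax px x0]] := lift_component hpi (a *: delta_mx (i0 u) (i0 u)).
  exists (d *m x *m d).
    split; first by do 2!apply: (subalgM hA) => //.
      by rewrite !mulmxA dd.
    by rewrite -!mulmxA dd.
  rewrite /theta !(piM hpi) ?pd ?px //; last exact: (subalgM hA).
  by rewrite delta_sandwich !mxE !eqxx !mulr1.
have theta_nil x : corner A d x -> theta x = 0 -> exists m : nat, x ^+ m = 0.
  move=> Cx tx; have [Ax dx xd] := Cx.
  apply: (lifts_nilpotent J_nil hpi (u := u)); split=> // [|v vu].
    by rewrite corner_pi // tx scale0r.
  by rewrite -dx (piM hpi) // d0 // mul0mx.
have [g [S [tau [[ug def_d] tauP tau_rel]]]] := corner_section hA hclosed Cd thetaD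
  thetaM thetaZ theta_d theta_surj theta_nil hq.
exists g, S, tau; split=> // [a|i].
  have [Ta ta] := tauP a; split; first by case: Ta.
  by rewrite corner_pi // ta.
have [Si|Si] := boolP (i \in S); last first.
  by move=> a; have [Ta _] := tauP a; apply: (diag_corner_supp ug def_d Ta Si).
exact: (section_rmorphism hA Cd thetaD thetaM thetaZ theta_d theta_nil (conj ug def_d) tauP Si).
Qed.

Section SemisimplePart.

Variables (d : forall u : 'I_k, 'M[K]_n) (a b : forall u, 'I_(nu u) -> 'M[K]_n).
Arguments a : clear implicits.
Arguments b : clear implicits.
Hypothesis ab_unit : forall u j,
  [/\ lifts A pi (delta_mx (i0 u) j) (a u j), d u *m a u j = a u j,
      lifts A pi (delta_mx j (i0 u)) (b u j) & b u j *m d u = b u j].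
Hypothesis ab : forall u i j, a u i *m b u j = if i == j then d u else 0.
Hypothesis ab_neq : forall u v i j, u != v -> a u i *m b v j = 0.
Variables (g : 'I_k -> 'M[K]_n) (S : 'I_k -> pred 'I_n).
Variable tau : forall u, 'I_n -> L u -> K.
Arguments tau : clear implicits.
Hypothesis tauP : forall u, diagonal_section (d u) (g u) (S u) (tau u).

Let ug u : g u \in unitmx. Proof. by case: (tauP u). Qed.

Let A_a u j : A (a u j). Proof. by case: (ab_unit j) => -[]. Qed.
Let A_b u j : A (b u j). Proof. by case: (ab_unit j) => _ _ []. Qed.

Definition scalar_section u (c : L u) : 'M[K]_n := dg (g u) ((tau u)^~ c).

Lemma scalar_sectionP u c : A (scalar_section c) /\
  pi u (scalar_section c) = c *: delta_mx (i0 u) (i0 u).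
Proof. by case: (tauP u) => _ _ + _ _; apply. Qed.

Lemma tau_rmorphism u i : i \in S u ->
  exists2 sg : {rmorphism L u -> K}, sg =1 tau u i & forall c, tau u i (alpha u c) = iota c.
Proof. by case: (tauP u) => _ _ _ /(_ i); case: ifP. Qed.

Lemma tau_off u i c : i \notin S u -> tau u i c = 0.
Proof. by case: (tauP u) => _ _ _ /(_ i); case: ifP => // _ + _ _; apply. Qed.

Lemma scalar_sectionD u (x y : L u) :
  scalar_section (x + y) = scalar_section x + scalar_section y.
Proof.
rewrite /scalar_section dgD; apply: dg_ext => i.
have [/tau_rmorphism[sg sgE _]|Si] := boolP (i \in S u).
  by rewrite -!sgE rmorphD.
by rewrite !tau_off // addr0.
Qed.

Lemma scalar_sectionM u (x y : L u) :
  scalar_section (x * y) = scalar_section x *m scalar_section y.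
Proof.
rewrite /scalar_section dgM //; apply: dg_ext => i.
have [/tau_rmorphism[sg sgE _]|Si] := boolP (i \in S u).
  by rewrite -!sgE rmorphM.
by rewrite !tau_off // mul0r.
Qed.

Lemma scalar_sectionZ u c (x : L u) :
  scalar_section (alpha u c * x) = iota c *: scalar_section x.
Proof.
rewrite /scalar_section dgZ; apply: dg_ext => i.
have [/tau_rmorphism[sg sgE sgA]|Si] := boolP (i \in S u).
  by rewrite -sgA -!sgE rmorphM.
by rewrite !tau_off // mulr0.
Qed.

Lemma scalar_section_unit u (x : L u) :
  d u *m scalar_section x = scalar_section x /\ scalar_section x *m d u = scalar_section x.
Proof.
have [_ -> _ _ _] := tauP u; rewrite /scalar_section !dgM //.
split; apply: dg_ext => i; have [Si|Si] := boolP (i \in S u).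
- by rewrite mul1r.
- by rewrite tau_off // mulr0.
- by rewrite mulr1.
by rewrite tau_off // mul0r.
Qed.

Lemma scalar_section_sum u (I : Type) (r : seq I) (f : I -> L u) :
  scalar_section (\sum_(i <- r) f i) = \sum_(i <- r) scalar_section (f i).
Proof.
elim: r => [|i r IHr]; last by rewrite !big_cons scalar_sectionD IHr.
rewrite !big_nil; have := scalar_sectionD (0 : L u) 0; rewrite addr0 => /eqP.
by rewrite -subr_eq0 opprD addrA subrr add0r oppr_eq0 => /eqP.
Qed.

(** The elements [b u i] and [a u j] play the part of the matrix units in the
    first column and in the first row. *)
Definition semisimple_section u (y : 'M[L u]_(nu u)) : 'M[K]_n :=
  \sum_i \sum_j b u i *m scalar_section (y i j) *m a u j.

Lemma subalg_semisimple_section u y : A (@semisimple_section u y).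
Proof.
apply: (subalg_sum hA) => i; apply: (subalg_sum hA) => j; do 2!apply: (subalgM hA) => //.
by case: (scalar_sectionP (y i j)).
Qed.

Lemma semisimple_sectionD u y z : @semisimple_section u (y + z) = semisimple_section y + semisimple_section z.
Proof.
rewrite /semisimple_section -big_split; apply: eq_bigr => i _; rewrite -big_split.
by apply: eq_bigr => j _; rewrite mxE scalar_sectionD mulmxDr mulmxDl.
Qed.

Lemma semisimple_sectionZ u c y : semisimple_section (alpha u c *: y) = iota c *: semisimple_section y.
Proof.
rewrite /semisimple_section scaler_sumr; apply: eq_bigr => i _; rewrite scaler_sumr.
by apply: eq_bigr => j _; rewrite mxE scalar_sectionZ -scalemxAr -scalemxAl.
Qed.

Lemma a_semisimple_section u j y : a u j *m semisimple_section y = \sum_j' scalar_section (y j j') *m a u j'.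
Proof.
rewrite /semisimple_section mulmx_sumr (bigD1 j) //= [X in _ + X]big1 ?addr0 => [|i ij].
  rewrite mulmx_sumr; apply: eq_bigr => j' _.
  rewrite mulmxA (mulmxA (a u j)) ab eqxx.
  by have [-> _] := scalar_section_unit (y j j').
rewrite mulmx_sumr big1 // => j' _.
by rewrite mulmxA (mulmxA (a u j)) ab eq_sym (negPf ij) !mul0mx.
Qed.

Lemma a_semisimple_section_neq u v j y : u != v -> a u j *m @semisimple_section v y = 0.
Proof.
move=> uv; rewrite /semisimple_section mulmx_sumr big1 // => i _; rewrite mulmx_sumr big1 // => j' _.
by rewrite mulmxA (mulmxA (a u j)) ab_neq // !mul0mx.
Qed.

Lemma semisimple_sectionM u y z : @semisimple_section u (y *m z) = semisimple_section y *m semisimple_section z.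
Proof.
rewrite {2}/semisimple_section mulmx_suml; apply: eq_bigr => i _; rewrite mulmx_suml.
rewrite [RHS](eq_bigr (fun j => \sum_l b u i *m scalar_section (y i j * z j l) *m a u l)).
  rewrite exchange_big; apply: eq_bigr => l _; rewrite mxE scalar_section_sum.
  by rewrite mulmx_sumr mulmx_suml.
move=> j _; rewrite -mulmxA a_semisimple_section mulmx_sumr; apply: eq_bigr => l _.
by rewrite scalar_sectionM mulmxA (mulmxA (b u i)).
Qed.

Lemma semisimple_sectionM_neq u v y z : u != v -> @semisimple_section u y *m @semisimple_section v z = 0.
Proof.
move=> uv; rewrite {1}/semisimple_section mulmx_suml big1 // => i _; rewrite mulmx_suml big1 // => j _.
by rewrite -mulmxA a_semisimple_section_neq // mulmx0.
Qed.

Lemma pi_semisimple_section u y : pi u (semisimple_section y) = y.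
Proof.
have Aterm i j : A (b u i *m scalar_section (y i j) *m a u j).
  by do 2!apply: (subalgM hA) => //; case: (scalar_sectionP (y i j)).
rewrite (pi_sum hA hpi) => [|i]; last exact: (subalg_sum hA).
rewrite [RHS]matrix_sum_delta; apply: eq_bigr => i _.
rewrite (pi_sum hA hpi) //; apply: eq_bigr => j _.
have [As ps] := scalar_sectionP (y i j); have Abs := subalgM hA (A_b i) As.
have [_ _ [_ pb _] _] := ab_unit i; have [[_ pa _] _ _ _] := ab_unit j.
by rewrite (piM hpi u Abs (A_a j)) (piM hpi u (A_b i) As) ps pb pa -scalemxAr -scalemxAl !mul_delta_mx.
Qed.

Lemma pi_semisimple_section_neq u v y : u != v -> pi v (@semisimple_section u y) = 0.
Proof.
move=> uv; have Aterm i j : A (b u i *m scalar_section (y i j) *m a u j).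
  by do 2!apply: (subalgM hA) => //; case: (scalar_sectionP (y i j)).
rewrite (pi_sum hA hpi) => [|i]; last exact: (subalg_sum hA).
rewrite big1 // => i _; rewrite (pi_sum hA hpi) // big1 // => j _.
have [As _] := scalar_sectionP (y i j); have Abs := subalgM hA (A_b i) As.
by have [[_ _ pa0] _ _ _] := ab_unit j; rewrite (piM hpi) // pa0 ?mulmx0 // eq_sym.
Qed.

Lemma wedderburn_decomposition x : A x -> J (x - \sum_u semisimple_section (pi u x)).
Proof.
move=> Ax; have As : A (\sum_u semisimple_section (pi u x)).
  by apply: (subalg_sum hA) => u; apply: subalg_semisimple_section.
have [_ _ _ J_ker _] := hpi; apply/J_ker => [|v]; first exact: (subalgB hA).
rewrite (piB hA hpi) // (pi_sum hA hpi) => [|u]; last exact: subalg_semisimple_section.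
rewrite (bigD1 v) //= pi_semisimple_section big1 ?addr0 ?subrr // => u uv.
exact: pi_semisimple_section_neq.
Qed.

(** A vector with the fewest nonzero coordinates is an eigenvector: if two
    coordinates had distinct eigenvalues, then one of the two combinations that
    cancel one of them would stay outside [U]. *)
Lemma eigenvector_outside u (N : 'rV[K]_n -> Prop) (U : 'M[K]_n) :
  (forall v w, N v -> N w -> N (v - w)) -> (forall c v, N v -> N (c *: v)) ->
  (forall (c : L u) v, N v -> N (v *m scalar_section c)) ->
  forall w, N w -> w *m d u = w -> ~~ (w <= U)%MS ->
  exists2 w', [/\ N w', w' *m d u = w' & ~~ (w' <= U)%MS] &
    exists2 i, i \in S u & forall c, w' *m scalar_section c = tau u i c *: w'.
Proof.
move=> NB NZ NS w; pose y (v : 'rV[K]_n) := v *m invmx (g u).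
have y_dg v f i : y (v *m dg (g u) f) 0 i = y v 0 i * f i.
  by rewrite /y /dg -!mulmxA mulmxV // mulmx1 mulmxA mul_mx_diag !mxE.
have y_inj v1 v2 : (forall i, y v1 0 i = y v2 0 i) -> v1 = v2.
  move=> eq_y; have {}eq_y : y v1 = y v2 by apply/rowP.
  by rewrite -[v1](mulmxKV (ug u)) -/(y v1) eq_y mulmxKV.
have [m] := ubnP #|[pred i | y w 0 i != 0]|; elim: m w => // m IHm w lt_m Nw wd wU.
have [i0 yi0] : exists i, y w 0 i != 0.
  apply: NNPP => no_i; case/negP: wU; rewrite (_ : w = 0) ?sub0mx //.
  apply: y_inj => i; rewrite [y 0]mul0mx [RHS]mxE; apply: NNPP => /eqP yi.
  by apply: no_i; exists i.
have supp_S i : y w 0 i != 0 -> i \in S u.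
  move=> yi; apply: contraR yi => Si; have [_ def_d _ _ _] := tauP u.
  by rewrite -wd def_d y_dg (negPf Si) mulr0.
have [eig|] := classic (forall i c, y w 0 i != 0 -> tau u i c = tau u i0 c).
  exists w; first by [].
  exists i0 => [|c]; first exact: supp_S.
  apply: y_inj => i; rewrite y_dg /y -scalemxAl [RHS]mxE -/(y w) mulrC.
  have [->|yi] := eqVneq (y w 0 i) 0; first by rewrite !mulr0.
  by rewrite eig.
move=> /not_all_ex_not[i1 /not_all_ex_not[c neq_c]].
have [yi1 tau_neq] := imply_to_and _ _ neq_c.
pose z i := w *m scalar_section c - tau u i c *: w.
have yz i j : y (z i) 0 j = y w 0 j * (tau u j c - tau u i c).
  have -> : y (z i) = y (w *m scalar_section c) - tau u i c *: y w.
    by rewrite /y mulmxBl scalemxAl.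
  by rewrite mxE y_dg !mxE mulrBr (mulrC (tau u i c)).
have [i [yi zU]] : exists i, y w 0 i != 0 /\ ~~ (z i <= U)%MS.
  have [z0|] := boolP (z i0 <= U)%MS; last by exists i0.
  exists i1; split=> //; apply: contra wU => z1.
  have -> : w = (tau u i1 c - tau u i0 c)^-1 *: (z i0 - z i1).
    rewrite /z opprB [_ + (_ - w *m _)]addrC addrA subrK -scalerBl scalerA mulVf ?scale1r //.
    by rewrite subr_eq0; apply/eqP.
  by rewrite scalemx_sub // addmx_sub // eqmx_opp.
apply: (IHm (z i)) => //.
- rewrite -ltnS; apply: leq_ltn_trans lt_m; apply: proper_card; apply/properP; split.
    by apply/subsetP => j; rewrite !inE yz; apply: contraNneq => ->; rewrite mul0r.
  by exists i; rewrite !inE // yz subrr mulr0 eqxx.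
- by apply: NB; [apply: NS | apply: NZ].
have [_ sd] := scalar_section_unit c.
by rewrite mulmxBl -mulmxA sd -scalemxAl wd.
Qed.

(** * Block bases of the module *)

Definition block_size (t : option 'I_k) : nat := if t is Some u then nu u else 1.

Definition block_rows (t : option 'I_k) (w : 'rV[K]_n) : 'M[K]_(block_size t, n) :=
  match t with Some u => \matrix_j (w *m a u j) | None => w end.

Definition eigenblock (t : option 'I_k) (w : 'rV[K]_n) : Prop :=
  match t with
  | Some u => w *m d u = w /\
      exists2 i, i \in S u & forall c, w *m scalar_section c = tau u i c *: w
  | None => w != 0 /\ forall u j, w *m b u j = 0
  end.

Lemma block_rows_section u w i y : (forall c, w *m scalar_section c = tau u i c *: w) ->
  block_rows (Some u) w *m semisimple_section y = map_mx (tau u i) y *m block_rows (Some u) w.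
Proof.
move=> w_eig; apply/row_matrixP => j; rewrite !row_mul rowK -mulmxA a_semisimple_section.
rewrite mulmx_sumr mulmx_sum_row; apply: eq_bigr => j' _.
by rewrite mulmxA w_eig rowK !mxE scalemxAl.
Qed.

Lemma block_rows_section_neq u t w y : eigenblock t w -> t != Some u ->
  block_rows t w *m @semisimple_section u y = 0.
Proof.
case: t => [v|] /= w_block tu.
  have vu : v != u by apply: contraNneq tu => ->.
  apply/row_matrixP => j; rewrite row_mul rowK -mulmxA a_semisimple_section_neq //.
  by rewrite mulmx0 row0.
rewrite /semisimple_section mulmx_sumr big1 // => i _; rewrite mulmx_sumr big1 // => j _.
by rewrite mulmxA (mulmxA w) w_block.2 !mul0mx.
Qed.

Implicit Types s : seq (option 'I_k * 'rV[K]_n).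

Definition block_span s : 'M[K]_n := (\sum_(p <- s) <<block_rows p.1 p.2>>)%MS.

Lemma block_span_cons p s : block_span (p :: s) = (<<block_rows p.1 p.2>> + block_span s)%MS.
Proof. by rewrite /block_span big_cons. Qed.

(** The list is read from the first diagonal block to the last: [J] maps each
    block into the span of the blocks behind it. *)
Fixpoint block_flag s : Prop :=
  if s is p :: s' then
    [/\ eigenblock p.1 p.2, forall x, J x -> (block_rows p.1 p.2 *m x <= block_span s')%MS,
        \rank (block_span s) = (block_size p.1 + \rank (block_span s'))%N & block_flag s']
  else True.

(** [A] is the sum of its semisimple part, which preserves each block, and
    of [J]. *)
Lemma block_flag_stable s x : block_flag s -> A x -> (block_span s *m x <= block_span s)%MS.
Proof.
elim: s => [_ _|p s IHs /= [p_block pJ _ /IHs stab_s] Ax].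
  by rewrite /block_span big_nil mul0mx sub0mx.
rewrite !block_span_cons addsmxMr addsmx_sub (submx_trans (stab_s Ax)) ?addsmxSr // andbT.
rewrite (eqmxMr _ (genmxE _)) -[x](subrK (\sum_u semisimple_section (pi u x))) mulmxDr.
apply: addmx_sub.
  apply: submx_trans (addsmxSr _ _); apply: pJ.
  exact: wedderburn_decomposition.
apply: submx_trans (addsmxSl _ _); rewrite genmxE mulmx_sumr summx_sub // => u _.
have [def_p|np] := eqVneq p.1 (Some u); last by rewrite block_rows_section_neq ?sub0mx.
case: p def_p p_block {pJ} => t w /= -> [_ [i _ w_eig]].
by rewrite (block_rows_section _ w_eig) submxMl.
Qed.

Lemma rank_adds_free m (B : 'M[K]_(m, n)) (U : 'M[K]_n) :
  (forall c : 'rV_m, (c *m B <= U)%MS -> c = 0) ->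
  \rank (<<B>> + U)%MS = (m + \rank U)%N.
Proof.
move=> B_free; rewrite mxrank_disjoint_sum; last first.
  apply/eqP/rowV0P => v; rewrite sub_capmx genmxE => /andP[/submxP[c ->] /B_free ->].
  by rewrite mul0mx.
congr addn; rewrite genmxE; apply/eqP; rewrite -[_ == _]/(row_free B) -kermx_eq0.
apply/rowV0P => v /sub_kermxP vB; apply: B_free.
by rewrite vB sub0mx.
Qed.

Let J_ideal : ideal_of iota A J. Proof. by case: J_nil. Qed.

(** A vector [v] outside the span [U] of the list with [v J] contained in [U]
    has a component [v b u j] outside [U], or else its component [w] in the
    common kernel of the matrix units is outside [U].  In the first case the
    component is replaced by an eigenvector, whose multiples by the [a u i] are
    independent modulo [U], since [b u i] recovers the [i]-th coefficient of a
    linear combination. *)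
Lemma block_flag_extend s : block_flag s -> ~~ row_full (block_span s) ->
  exists p, block_flag (p :: s).
Proof.
move=> s_flag; set U := block_span s; have [JA J0 JD JZ JM] := J_ideal.
have Jmul x y : J x -> J y -> J (x *m y) by move=> /JA Ax Jy; case: (JM x y).
have J_nilp x : J x -> exists m : nat, x ^+ m = 0 by case: J_nil => _; apply.
move=> /(nil_semigroup_action Jmul J_nilp)[v vU vJ].
pose N (w : 'rV[K]_n) := forall x, J x -> (w *m x <= U)%MS.
have NB w1 w2 : N w1 -> N w2 -> N (w1 - w2).
  by move=> N1 N2 x Jx; rewrite mulmxBl addmx_sub ?eqmx_opp ?N1 ?N2.
have NZ c w : N w -> N (c *: w) by move=> Nw x Jx; rewrite -scalemxAl scalemx_sub ?Nw.
have NA y w : A y -> N w -> N (w *m y).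
  by move=> Ay Nw x Jx; rewrite -mulmxA Nw //; case: (JM y x).
have [[u [j vbU]]|no_vb] := classic (exists u j, ~~ (v *m b u j <= U)%MS).
  have [_ _ _ bd] := ab_unit j.
  have [||w [Nw wd wU] w_eig] :=
      eigenvector_outside (u := u) (N := N) NB NZ _ (NA _ _ (A_b j) vJ) _ vbU.
  - by move=> c w; apply: NA; case: (scalar_sectionP c).
  - by rewrite -mulmxA bd.
  exists (Some u, w); split=> //.
  - move=> x Jx; apply/row_subP => i; rewrite row_mul rowK /=.
    by rewrite (NA _ _ (A_a i) Nw).
  rewrite block_span_cons /=; apply: rank_adds_free => c cU; apply/rowP=> i; rewrite [RHS]mxE.
  have : (c *m (\matrix_j (w *m a u j)) *m b u i <= U)%MS.
    apply: submx_trans (block_flag_stable s_flag (A_b i)).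
    exact: (submxMr _ cU).
  rewrite (mulmx_sum_row c) mulmx_suml (bigD1 i) //= big1 => [|i' i'i].
    rewrite addr0 rowK -scalemxAl -mulmxA ab eqxx wd => ciw.
    apply: contraNeq wU => ci; rewrite -[w]scale1r -(mulVf ci) -scalerA.
    exact: scalemx_sub.
  by rewrite rowK -scalemxAl -mulmxA ab (negPf i'i) mulmx0 scaler0.
have vb u j : (v *m b u j <= U)%MS.
  by apply: contraT => vbU; case: no_vb; exists u, j.
pose w := v - \sum_u \sum_j v *m b u j *m a u j.
have wU : ~~ (w <= U)%MS.
  apply: contra vU => wU; rewrite -[v](subrK (\sum_u \sum_j v *m b u j *m a u j)).
  rewrite addmx_sub // summx_sub // => u _; rewrite summx_sub // => j _.
  apply: submx_trans (block_flag_stable s_flag (A_a j)).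
  exact: submxMr.
exists (None, w); split=> //=.
- split=> [|u j]; first by apply: contraNneq wU => ->; rewrite sub0mx.
  rewrite mulmxBl; apply/eqP; rewrite subr_eq0; apply/eqP.
  rewrite mulmx_suml (bigD1 u) //= [X in _ + X]big1 ?addr0 => [|u' u'u].
    rewrite mulmx_suml (bigD1 j) //= [X in _ + X]big1 ?addr0 => [|j' j'j].
      by have [_ _ _ bd] := ab_unit j; rewrite -!mulmxA ab eqxx bd.
    by rewrite -(mulmxA _ (a u j')) ab (negPf j'j) mulmx0.
  rewrite mulmx_suml big1 // => j' _.
  by rewrite -(mulmxA _ (a u' j')) ab_neq // mulmx0.
- apply: NB => // x Jx; rewrite mulmx_suml summx_sub // => u _.
  rewrite mulmx_suml summx_sub // => j _.
  by apply: (NA _ _ (A_a j)) => //; apply: (NA _ _ (A_b j)).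
rewrite block_span_cons /=; apply: rank_adds_free => c cU; apply/rowP=> i; rewrite [RHS]mxE.
apply: contraNeq wU => ci; rewrite ord1 in ci.
rewrite -[w]scale1r -(mulVf ci) -scalerA scalemx_sub //.
by rewrite -mul_scalar_mx -mx11_scalar.
Qed.

Lemma block_flag_full : exists2 s, block_flag s & row_full (block_span s).
Proof.
suff main m s : (n - \rank (block_span s) <= m)%N -> block_flag s ->
    exists2 s', block_flag s' & row_full (block_span s').
  exact: (main _ [::] (leqnn _)).
elim: m s => [|m IHm] s lem s_flag.
  exists s => //; rewrite /row_full eqn_leq rank_leq_row -subn_eq0.
  by rewrite -leqn0.
have [full|nfull] := boolP (row_full (block_span s)); first by exists s.
have [p ps] := block_flag_extend s_flag nfull.
apply: (IHm (p :: s)) => //; case: ps => _ _ -> _.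
have size_gt0 : (0 < block_size p.1)%N by case: p.1 => [u|] //=; apply: hnu.
rewrite -ltnS; apply: leq_trans lem; apply: ltn_sub2l.
  by rewrite ltn_neqAle rank_leq_row andbT.
by rewrite -[X in (X < _)%N]add0n ltn_add2r.
Qed.

Lemma block_flag_rank s : block_flag s -> \rank (block_span s) = (\sum_(p <- s) block_size p.1)%N.
Proof.
elim: s => [_|p s IHs /= [_ _ rk /IHs rk_s]]; first by rewrite /block_span !big_nil mxrank0.
by rewrite rk rk_s big_cons.
Qed.

Lemma block_flag_nth p0 s l : block_flag s -> (l < size s)%N ->
  eigenblock (nth p0 s l).1 (nth p0 s l).2 /\
  forall x, J x -> (block_rows (nth p0 s l).1 (nth p0 s l).2 *m x <= block_span (drop l.+1 s))%MS.
Proof.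
elim: s l => [|p s IHs] [|l] //= [p_block pJ _ s_flag]; first by rewrite drop0.
exact: IHs.
Qed.

Lemma block_span_drop p0 s m : (block_span (drop m s) <=
  \sum_(l < size s | (m <= l)%N) <<block_rows (nth p0 s l).1 (nth p0 s l).2>>)%MS.
Proof.
rewrite /block_span (big_nth p0) big_mkord; apply/sumsmx_subP => i _.
have lt_i : (m + i < size s)%N.
  by rewrite -ltn_subRL -size_drop ltn_ord.
by rewrite nth_drop (sumsmx_sup (Ordinal lt_i)) //= leq_addr.
Qed.

(** The vectors [w a_j] span a copy of the natural module of [A_u], twisted by
    the embedding through which the scalars act on the eigenvector [w]. *)
Lemma block_rows_coords u t w : eigenblock t w -> exists X : 'M[L u]_(nu u) -> 'M[K]_(block_size t),
  [/\ forall y, block_rows t w *m semisimple_section y = X y *m block_rows t w,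
      t != Some u -> forall y, X y = 0
    & t = Some u -> exists2 i, i \in S u &
        forall (hl : block_size t = nu u) y, castmx (hl, hl) (X y) = map_mx (tau u i) y].
Proof.
move=> w_block; have [tu|tu] := eqVneq t (Some u); last first.
  exists (fun=> 0); split=> // [y|/eqP]; last by rewrite (negPf tu).
  by rewrite block_rows_section_neq // mul0mx.
rewrite tu in w_block *; have [_ [i Si w_eig]] := w_block.
exists (map_mx (tau u i)); split=> [y||_]; first exact: block_rows_section.
  by rewrite ?eqxx.
by exists i => // hl y; rewrite (eq_irrelevance hl (erefl _)) castmx_id.
Qed.

(** If [A] contains the identity, then the complement of the sum of the lifted
    diagonal units is an idempotent of [J], hence zero. *)
Lemma unit_no_empty_block w : eigenblock None w -> ~ A 1%:M.
Proof.
move=> /= [/eqP w0 w_block] A1; case: w0.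
pose e := \sum_u \sum_j b u j *m a u j.
have eb u j : e *m b u j = b u j.
  rewrite /e mulmx_suml (bigD1 u) //= [X in _ + X]big1 ?addr0 => [|v vu].
    rewrite mulmx_suml (bigD1 j) //= [X in _ + X]big1 ?addr0 => [|i ij].
      by have [_ _ _ bd] := ab_unit j; rewrite -mulmxA ab eqxx bd.
    by rewrite -mulmxA ab (negPf ij) mulmx0.
  by rewrite mulmx_suml big1 // => i _; rewrite -mulmxA ab_neq // mulmx0.
have ee : e *m e = e.
  rewrite {2}/e mulmx_sumr; apply: eq_bigr => u _; rewrite mulmx_sumr.
  by apply: eq_bigr => j _; rewrite mulmxA eb.
have Aba u j : A (b u j *m a u j) by apply: (subalgM hA).
have Ae : A e by apply: (subalg_sum hA) => u; apply: (subalg_sum hA).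
have pi_e u : pi u e = 1%:M.
  rewrite (pi_sum hA hpi) => [|v]; last exact: (subalg_sum hA).
  rewrite (bigD1 u) //= [X in _ + X]big1 ?addr0 => [|v vu].
    rewrite (pi_sum hA hpi) // -diag_const_mx diag_mx_sum_delta; apply: eq_bigr => j _.
    have [[_ pa _] _ [_ pb _] _] := ab_unit j.
    by rewrite (piM hpi) // pa pb mul_delta_mx mxE scale1r.
  rewrite (pi_sum hA hpi) // big1 // => j _.
  have [[_ _ pa0] _ _ _] := ab_unit j.
  by rewrite (piM hpi) // pa0 ?mulmx0 // eq_sym.
have pi_1 u : pi u 1%:M = 1%:M.
  by rewrite -[LHS]mulmx1 -pi_e -(piM hpi) ?mul1mx.
have A1e : A (1%:M - e) by apply: (subalgB hA).
have e1 : 1%:M - e = 0.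
  apply: (pi_idempotent0 J_nil hpi) => // [|u].
    by rewrite mulmxBl mul1mx mulmxBr mulmx1 ee subrr subr0.
  by rewrite (piB hA hpi) // pi_1 pi_e subrr.
rewrite -[w]mulmx1 -[1%:M](subrK e) e1 add0r mulmx_sumr big1 // => u _.
by rewrite mulmx_sumr big1 // => j _; rewrite mulmxA w_block mul0mx.
Qed.

Lemma block_form : exists (e : 'I_n -> 'I_n -> 'M[K]_n) (D : layout n nu)
    (phi : forall u, 'M[L u]_(nu u) -> 'M[K]_n),
  [/\ matrix_units e, wedderburn_block_form iota A J alpha pi e D phi
    & forall u (l l' : 'I_(nblocks D)) (hl : btype l = Some u) (hl' : btype l' = Some u),
      exists s1 s2 : L u -> K, [/\ frobenius_related q s1 s2,
        forall y, diag_block (phi u y) hl = map_mx s1 y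
      & forall y, diag_block (phi u y) hl' = map_mx s2 y]].
Proof.
have [s s_flag s_full] := block_flag_full.
pose p0 : option 'I_k * 'rV[K]_n := (None, 0).
pose bt (l : 'I_(size s)) := (nth p0 s l).1; pose bs l := block_size (bt l).
have bsE l u : bt l = Some u -> bs l = nu u by rewrite /bs => ->.
have bs_sum : (\sum_l bs l)%N = n.
  transitivity (\rank (block_span s)); last exact/eqP.
  by rewrite block_flag_rank // (big_nth p0) big_mkord.
pose D : layout n nu := Layout bsE bs_sum.
pose bb (l : 'I_(nblocks D)) : 'M[K]_(bsize l, n) := block_rows (bt l) (nth p0 s l).2.
pose G := block_basis bb.
have uG : G \in unitmx.
  apply: block_basis_unit; rewrite (_ : \sum_l <<bb l>> = block_span s)%MS //.
  by rewrite /block_span (big_nth p0) big_mkord.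
pose phi u (y : 'M[L u]_(nu u)) := G *m semisimple_section y *m invmx G.
have phiE u y : of_coords (conj_units G) (phi u y) = semisimple_section y.
  by rewrite of_conj_coords /phi !mulmxA mulVmx // mul1mx -mulmxA mulVmx // mulmx1.
have bb_flag (l : 'I_(nblocks D)) := block_flag_nth p0 s_flag (ltn_ord l).
have X_ex (l : 'I_(nblocks D)) : exists X : forall u, 'M[L u]_(nu u) -> 'M[K]_(bs l),
    forall u, [/\ forall y, bb l *m semisimple_section y = X u y *m bb l,
      bt l != Some u -> forall y, X u y = 0
    & bt l = Some u -> exists2 i, i \in S u &
        forall (hl : bs l = nu u) y, castmx (hl, hl) (X u y) = map_mx (tau u i) y].
  have [w_block _] := bb_flag l.
  exact: (dependent_choice (fun u => block_rows_coords u w_block)).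
have [X XP] := dependent_choice X_ex.
pose M u y (l l' : 'I_(nblocks D)) : 'M[K]_(bsize l, bsize l') :=
  if l == l' then conform_mx 0 (X l u y) else 0.
have block_phi u y l l' : block (phi u y) l l' = M u y l l'.
  apply: (block_basis_mul (b := bb) (x := semisimple_section y)) => //.
    by rewrite /phi mulmxKV.
  move=> l1; have [-> _ _] := XP l1 u.
  rewrite (bigD1 l1) //= /M eqxx conform_mx_id [X in _ + X]big1 ?addr0 //.
  by move=> l2 /negPf; rewrite eq_sym => ->; rewrite mul0mx.
have diag_phi u (l : 'I_(nblocks D)) (hl : btype l = Some u) : exists2 i, i \in S u &
    forall y, diag_block (phi u y) hl = map_mx (tau u i) y.
  have [_ _ /(_ hl)[i Si XE]] := XP l u; exists i => // y.
  rewrite /diag_block block_phi /M eqxx conform_mx_id; exact: XE.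
exists (conj_units G), D, phi; split; first exact: conj_matrix_units.
- split.
  + split=> [u y|u y z|u y z|u c y|]; rewrite ?phiE.
    * exact: subalg_semisimple_section.
    * exact: semisimple_sectionD.
    * exact: semisimple_sectionM.
    * exact: semisimple_sectionZ.
    split=> [u y|u v y z uv]; rewrite ?phiE; first exact: pi_semisimple_section.
    by split; [apply: semisimple_sectionM_neq | apply: pi_semisimple_section_neq].
  + move=> u y l l' off; rewrite block_phi /M; case: eqP => // ll'.
    move: off; rewrite ll' eqxx /= => tl'; have [_ X0 _] := XP l' u.
    by case: l' / ll' tl' X0 => tl X0; rewrite conform_mx_id X0.
  + move=> u l hl y z; have [i Si phiD] := diag_phi u l hl.
    rewrite !phiD => /matrixP yz; apply/matrixP => r r'; have := yz r r'; rewrite !mxE.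
    by have [sg sgE _] := tau_rmorphism Si; rewrite -!sgE; apply: fmorph_inj.
  + move=> c; rewrite of_conj_coords => Jc.
    set x := invmx G *m c *m G in Jc.
    have M1_ex (l : 'I_(nblocks D)) : exists M1 : forall l', 'M[K]_(bs l, bs l'),
        bb l *m x = \sum_l' M1 l' *m bb l' /\
        forall l' : 'I_(size s), (l' <= l)%N -> M1 l' = 0.
      have [_ /(_ x Jc) bx] := bb_flag l.
      have /sub_sumsmxP[v vE] := submx_trans bx (block_span_drop p0 s l.+1).
      exists (fun l' : 'I_(size s) => if (l < l')%N then v l' *m <<bb l'>>%MS *m pinvmx (bb l') else 0).
      split=> [|l' le_l']; last by rewrite ltnNge le_l'.
      rewrite [LHS]vE [LHS]big_mkcond; apply: eq_bigr => l' _.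
      case: ifP => _; last by rewrite mul0mx.
      by rewrite mulmxKpV // (submx_trans (submxMl _ _)) ?genmxE.
    have [M1 M1P] := dependent_choice M1_ex.
    move=> l l' le_l'; rewrite (block_basis_mul (b := bb) (x := x) (M := M1)) //.
    * by have [_ ->] := M1P l.
    * by rewrite /x !mulmxA mulmxV // mul1mx.
    by move=> l1; have [] := M1P l1.
  + case=> l tl; have [w_block _] := bb_flag l.
    by move: w_block; rewrite -/(bt l) [bt l]tl; apply: unit_no_empty_block.
- move=> u l l' hl hl'; have [i Si phi_l] := diag_phi u l hl.
  have [i' Si' phi_l'] := diag_phi u l' hl'.
  exists (tau u i), (tau u i'); split=> //.
  by case: (tauP u) => _ _ _ _; apply.
Qed.

End SemisimplePart.

End Wedderburn.

(** * Frobenius gluing *)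

Lemma exp_frobenius_inj (F K : fieldType) (iota : {rmorphism F -> K}) q e :
  frobenius_base F q -> injective (fun x : K => x ^+ (q ^ e)).
Proof.
case=> [[s [us mem_s def_q]]|[_ ->]]; last by rewrite exp1n => x y /=; rewrite !expr1.
have [_ [p [f [pchF _ ->]]]] := finite_field_structure us mem_s def_q.
by rewrite -expnM; apply: exp_pchar_inj; apply: (rmorph_pchar iota).
Qed.

(** The same element [y] gives both blocks; the exponent of the gluing is that of
    the relation between the embeddings, and powers of [q] are injective
    on [K]. *)
Lemma frobenius_gluing_of_related (F K : fieldType) (iota : {rmorphism F -> K}) q
    (M : fieldType) n k (nu : 'I_k -> nat) (D : layout n nu) u
    (phi : 'M[M]_(nu u) -> 'M[K]_n) (l l' : 'I_(nblocks D))
    (hl : btype l = Some u) (hl' : btype l' = Some u) (s1 s2 : M -> K) :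
  frobenius_base F q -> frobenius_related q s1 s2 ->
  (forall y, diag_block (phi y) hl = map_mx s1 y) ->
  (forall y, diag_block (phi y) hl' = map_mx s2 y) ->
  exists d : int, frobenius_gluing phi hl hl' q d.
Proof.
move=> hq [e rel] phi1 phi2.
suff main (d : int) : (forall kappa m (x : M) (c : K), m%:Z = d + kappa%:Z ->
    s1 x = c ^+ (q ^ m) -> s2 x = c ^+ (q ^ kappa)) -> frobenius_gluing phi hl hl' q d.
  case: rel => rel; [exists e%:Z | exists (- e%:Z)]; apply: main => kappa m x c.
    move=> [->]; rewrite rel => s12; apply: (exp_frobenius_inj (e := e) iota hq).
    by rewrite /= s12 -exprM -expnD addnC.
  move/eqP; rewrite addrC eq_sym subr_eq => /eqP[->] s1x.
  by rewrite rel s1x -exprM -expnD.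
move=> s_rel; exists 0%N => kappa m _ def_m a [y]; rewrite phi1 => s1y.
exists y; rewrite phi1 s1y phi2; split=> //; apply/matrixP => i j; rewrite !mxE.
by apply: (s_rel kappa m) => //; have /matrixP/(_ i j) := s1y; rewrite !mxE.
Qed.

Local Close Scope ring_scope.

Theorem theorem5p14
  (F : fieldType) (K : closedFieldType) (iota : {rmorphism F -> K})
  (q : nat) (hq : frobenius_base F q)
  (n : nat) (A J : 'M[K]_n -> Prop)
  (hA : subalgebra iota A) (hclosed : zariski_closed A)
  (hJ : is_radical iota A J)
  (k : nat) (nu : 'I_k -> nat) (hnu : forall u, 0 < nu u)
  (L : 'I_k -> fieldType)
  (alpha : forall u, {rmorphism F -> L u})
  (emb : forall u, {rmorphism L u -> K})
  (pi : forall u, 'M[K]_n -> 'M[L u]_(nu u))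
  (hpi : quotient_isomorphism iota A J alpha pi) :
  exists (e : 'I_n -> 'I_n -> 'M[K]_n) (D : layout n nu)
         (phi : forall u, 'M[L u]_(nu u) -> 'M[K]_n),
    [/\ matrix_units e,
        wedderburn_block_form iota A J alpha pi e D phi
      & forall (u : 'I_k) (l l' : 'I_(nblocks D))
               (hl : btype l = Some u) (hl' : btype l' = Some u),
          exists d : int, frobenius_gluing (phi u) hl hl' q d].
Proof.
have [J_nil _] := hJ.
have [d [a [b [d_unit ab_unit ab ab_neq]]]] := lift_matrix_units hA J_nil hnu hpi.
have frame_ex u : exists f : 'M[K]_n * pred 'I_n * ('I_n -> L u -> K),
    diagonal_section iota q A hnu alpha pi (d u) f.1.1 f.1.2 f.2.
  have [ld dd] := d_unit u.
  have [g [S [tau frame_u]]] := component_section hq hA hclosed J_nil hpi ld dd.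
  by exists (g, S, tau).
have [f fP] := dependent_choice frame_ex.
have [e [D [phi [e_units form glue]]]] :=
  block_form hA J_nil hpi ab_unit ab ab_neq fP.
exists e, D, phi; split=> // u l l' hl hl'.
have [s1 [s2 [rel phi1 phi2]]] := glue u l l' hl hl'.
exact: (frobenius_gluing_of_related iota hq rel phi1 phi2).
Qed.
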